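(* Let $X$ be a coanalytic subspace of the Cantor set $2^\omega$. Then the following are equivalent: (1) $X$ is Polish; (2) $X^\omega$ is countable dense homogeneous.
   Context: Space means separable metrizable topological space; countable means at most countable. $X^\omega$ is the product of countably infinitely many copies of $X$ with the product topology. A space is Polish if it admits a complete metric (compatible with its topology). A subspace of a Polish space is analytic if it is the continuous image of a Polish space, and coanalytic if its complement is analytic. A space $X$ is countable dense homogeneous if for every pair $(A,B)$ of countable dense subsets of $X$ there exists a homeomorphism $h:X\to X$ such that $h[A]=B$. *)

(* Defs.v *)
From HB Require Import structures.
From mathcomp Require Import all_boot all_order all_algebra.
From mathcomp Require Import all_classical all_reals topology cantor.

Set Implicit Arguments.
Unset Strict Implicit.
Unset Printing Implicit Defensive.

Import Order.TTheory GRing.Theory Num.Theory.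

Local Open Scope classical_set_scope.
Local Open Scope ring_scope.

Definition separable_space (T : topologicalType) : Prop :=
  exists2 D : set T, countable D & dense D.

Section compatible_metrics.
Context {R : realType} {T : topologicalType}.
Implicit Type d : T -> T -> R.

Definition is_metric d : Prop :=
  [/\ forall x y, 0 <= d x y,
      forall x y, d x y = 0 <-> x = y,
      forall x y, d x y = d y x &
      forall x y z, d x z <= d x y + d y z].

Definition compatible_dist d : Prop := forall (x : T) (U : set T),
  nbhs x U <-> exists2 e : R, 0 < e & [set y | d x y < e] `<=` U.

Definition cauchy_seq d (u : nat -> T) : Prop := forall e : R, 0 < e ->
  exists N : nat, forall m n, (N <= m)%N -> (N <= n)%N -> d (u m) (u n) < e.

Definition complete_dist d : Prop := forall u : nat -> T, cauchy_seq d u ->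
  exists l : T, u @ \oo --> l.

End compatible_metrics.

(* Spaces are separable and metrizable by convention, hence the separability
   conjunct. *)
Definition polish (R : realType) (T : topologicalType) : Prop :=
  separable_space T /\
  exists d : T -> T -> R, [/\ is_metric d, compatible_dist d & complete_dist d].

Definition analytic (R : realType) (Z : topologicalType) (A : set Z) : Prop :=
  exists (P : topologicalType) (f : P -> Z),
    [/\ polish R P, continuous f & range f = A].

Definition coanalytic (R : realType) (Z : topologicalType) (A : set Z) : Prop :=
  analytic R (~` A).

Definition homeomorphism (S T : topologicalType) (h : S -> T) : Prop :=
  exists g : T -> S, [/\ cancel h g, cancel g h, continuous h & continuous g].

Definition countable_dense_homogeneous (T : topologicalType) : Prop :=
  forall A B : set T, countable A -> dense A -> countable B -> dense B ->
    exists2 h : T -> T, homeomorphism h & h @` A = B.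

Definition omega_power (T : topologicalType) : topologicalType :=
  prod_topology (fun _ : nat => T).

(* Main.v *)
Require Import Defs.
From mathcomp Require Import all_boot all_order all_algebra.
From mathcomp Require Import all_classical all_reals topology cantor.

(**
  All spaces are handled through embeddings into the Cantor set, where the
  topology is given by agreement of finite prefixes; a sequence of points of
  [X] is coded by interleaving its terms.

  If [X] is Polish, it is a G_delta in the Cantor set.  Given a countable dense
  set [A] of the power, a scheme of clopen pieces with a marked point of [A] in
  each piece (binary branching if [X] is compact, infinite branching otherwise)
  identifies the power with all sequences of indices so that [A] becomes the
  set of eventually constant-[j0] sequences.  Composing two such codings
  sends one countable dense set to another.

  If [X] is not Polish, Hurewicz's argument gives a countable crowded
  [Q] closed in [X].  By the Baire property of the analytic complement of [X],
  either the complement is meager relative to [X], or some nonempty open part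
  of [X] is meager in itself.  In the first case the power has a countable
  dense subset contained in a Polish subspace, while another one contains a
  copy of [Q]; in the second case it has a countable dense G_delta
  subset, while another one contains a countable dense subset of a
  Cantor set [{a, b}^omega].  Neither pair can be matched, because a countable
  crowded set is never a G_delta of the Cantor set.
*)

Set Implicit Arguments.
Unset Strict Implicit.
Unset Printing Implicit Defensive.

Import Order.TTheory GRing.Theory Num.Theory.

Local Open Scope classical_set_scope.

Implicit Types (u v : seq bool) (z w : nat -> bool).

(** * Prefixes and embeddings into the Cantor set *)

Lemma ex_least (P : nat -> Prop) : (exists n, P n) ->
  exists2 n, P n & forall m, P m -> (n <= m)%N.
Proof.
move=> exP; have ex : exists n, `[< P n >] by have [n ?] := exP; exists n; apply/asboolP.
exists (ex_minn ex); first by case: ex_minnP => n /asboolP.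
by move=> m Pm; case: ex_minnP => n _; apply; apply/asboolP.
Qed.

Definition pre n z : seq bool := mkseq z n.

Lemma size_pre n z : size (pre n z) = n.
Proof. exact: size_mkseq. Qed.

Lemma preP n z w : pre n z = pre n w <-> forall i, (i < n)%N -> z i = w i.
Proof.
split=> [e i lin|e].
  by rewrite -(nth_mkseq false z lin) -(nth_mkseq false w lin) -/(pre n z) e.
apply: (@eq_from_nth _ false); rewrite !size_mkseq // => i lin.
by rewrite !nth_mkseq // e.
Qed.

Lemma pre_le m n z w : (m <= n)%N -> pre n z = pre n w -> pre m z = pre m w.
Proof. by move=> mn /preP e; apply/preP => i im; apply: e; apply: leq_trans mn. Qed.

Lemma pre_inj z w : (forall n, pre n z = pre n w) -> z = w.
Proof. by move=> e; apply/funext => i; move/preP: (e i.+1); apply. Qed.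

Lemma pre_neq z w : z <> w -> exists n, pre n z <> pre n w.
Proof.
move=> zw; apply: contrapT => /forallNP h; apply: zw; apply: pre_inj => n.
by apply: contrapT.
Qed.

Definition cyl u : set (nat -> bool) := [set z | pre (size u) z = u].

Lemma cyl_pre n z w : cyl (pre n z) w <-> pre n w = pre n z.
Proof. by rewrite /cyl /= size_pre. Qed.

(** Topological embeddings into the Cantor set, phrased through prefixes: continuity and openness
    become agreement of finitely many bits. *)
Definition embeds (T : topologicalType) (c : T -> nat -> bool) : Prop :=
  injective c /\ forall (x : T) (U : set T),
    nbhs x U <-> exists n, forall y, pre n (c y) = pre n (c x) -> U y.

(** The sets on the right form a filter, which converges to [x] because it does so in each
    coordinate; conversely, a basic set is a finite intersection of preimages of neighbourhoods
    under projections. *)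
Lemma nbhs_prod (T : nat -> topologicalType) (c : forall i, T i -> nat -> bool)
    (x : prod_topology T) (U : set (prod_topology T)) :
    (forall i, embeds (c i)) ->
  nbhs x U <-> exists n, forall y : prod_topology T,
    (forall i, (i < n)%N -> pre n (c i (y i)) = pre n (c i (x i))) -> U y.
Proof.
move=> ec; pose F : set_system (prod_topology T) := [set V | exists n,
  forall y : prod_topology T,
    (forall i, (i < n)%N -> pre n (c i (y i)) = pre n (c i (x i))) -> V y].
split.
  have FF : Filter F.
    split; first by exists 0%N.
      move=> V W [n nV] [m mW]; exists (maxn n m) => y ye; split.
        apply: nV => i lin; apply: (pre_le (leq_maxl n m)); apply: ye.
        by rewrite leq_max lin.
      apply: mW => i lin; apply: (pre_le (leq_maxr n m)); apply: ye.
      by rewrite leq_max lin orbT.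
    by move=> V W VW [n nV]; exists n => y /nV /VW.
  move: U; suff : F --> x by [].
  apply/cvg_sup => i V /= [_ [[B Bop <-] /= Bx] BV].
  have /(ec i).2 [n nB] : nbhs (x i) B by apply: open_nbhs_nbhs.
  exists (maxn i.+1 n) => y ye; apply: BV; apply: nB.
  by apply: (pre_le (leq_maxr i.+1 n)); apply: ye; rewrite leq_max ltnSn.
move=> [n nU].
suff H m : nbhs x [set y : prod_topology T |
    forall i, (i < m)%N -> pre n (c i (y i)) = pre n (c i (x i))].
  by apply: filterS (H n).
elim: m => [|m IH]; first by apply: filterS filterT => y _ i.
have nm : nbhs x [set y : prod_topology T | pre n (c m (y m)) = pre n (c m (x m))].
  have Vm : nbhs (x m) [set t | pre n (c m t) = pre n (c m (x m))].
    by apply/(ec m).2; exists n.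
  exact: (@proj_continuous nat T m x _ Vm).
apply: filterS2 IH nm => y e1 e2 i; rewrite ltnS leq_eqVlt => /orP[/eqP -> //|].
exact: e1.
Qed.

Lemma embeds_bool : @embeds bool (fun b _ => b).
Proof.
split=> [b b' /(congr1 (@^~ 0%N)) //|b U]; split.
  move=> /nbhs_singleton Ub; exists 1%N => b' /preP/(_ 0%N isT) ->.
  exact: Ub.
move=> [n nU]; apply: (@filterS _ (nbhs b) _ [set b]); last exact: discrete_set1.
by move=> _ ->; apply: nU.
Qed.

Lemma embeds_cantor : @embeds cantor_space id.
Proof.
split=> // z U.
rewrite (@nbhs_prod (fun _ => bool) (fun _ b _ => b) z U (fun=> embeds_bool)).
split=> -[n nU]; exists n => w e; apply: nU.
  by move=> i lin; apply/preP => j _; move/preP: e; exact.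
apply/preP => i lin; have := e i lin.
by move/preP/(_ 0%N (leq_ltn_trans (leq0n i) lin)).
Qed.

Lemma embeds_set (X : set cantor_space) :
  @embeds (X : topologicalType) (fun x => \val x).
Proof.
split=> [|x U]; first exact: val_inj.
split.
  move=> [_ [[B Bop <-] /= Bx] BU].
  have oB : open_nbhs (set_val x) B by [].
  have [n nB] := (embeds_cantor.2 _ _).1 (open_nbhs_nbhs oB).
  by exists n => y e; apply: BU; apply: nB.
move=> [n nU].
have nV : nbhs (set_val x : cantor_space) [set w | pre n w = pre n (\val x)].
  by apply/embeds_cantor.2; exists n.
have := @initial_continuous X cantor_space set_val x _ nV.
by apply: (@filterS _ (nbhs x)) => y; apply: nU.
Qed.

(** * Coding sequences of points by interleaving bits *)

Lemma nat2_bij : exists f : nat -> nat * nat, exists2 g, cancel f g & cancel g f.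
Proof.
have := card_nat2; rewrite card_eq_sym => /card_set_bijP[f].
by rewrite setTT_bijective => -[g fK gK]; exists f; exists g.
Qed.

Definition unpair : nat -> nat * nat := projT1 (cid nat2_bij).

Definition pairn : nat * nat -> nat := s2val (cid2 (projT2 (cid nat2_bij))).

Lemma unpairK : cancel unpair pairn.
Proof. exact: s2valP (cid2 (projT2 (cid nat2_bij))). Qed.

Lemma pairnK : cancel pairn unpair.
Proof. exact: s2valP' (cid2 (projT2 (cid nat2_bij))). Qed.

Definition slice i z : nat -> bool := fun j => z (pairn (i, j)).

Lemma slice_pre i m : exists n, forall z w,
  pre n z = pre n w -> pre m (slice i z) = pre m (slice i w).
Proof.
exists (\max_(j < m) (pairn (i, nat_of_ord j)).+1) => z w /preP e.
apply/preP => j jm; apply: e.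
exact: (@leq_bigmax _ (fun j : 'I_m => (pairn (i, nat_of_ord j)).+1) (Ordinal jm)).
Qed.

Section omega_coding.
Variable X : set cantor_space.
Local Notation Y := (omega_power X).
Implicit Types x y : Y.

Definition omega_code y : nat -> bool := fun k => \val (y (unpair k).1) (unpair k).2.

Lemma slice_omega_code i y : slice i (omega_code y) = \val (y i).
Proof. by apply/funext => j; rewrite /slice /omega_code pairnK. Qed.

Lemma omega_code_pre n : exists N, forall x y,
  (forall i, (i < N)%N -> pre N (\val (x i)) = pre N (\val (y i))) ->
  pre n (omega_code x) = pre n (omega_code y).
Proof.
exists (\max_(k < n) (maxn (unpair k).1 (unpair k).2).+1) => x y e.
apply/preP => k kn; rewrite /omega_code.
have := @leq_bigmax _ (fun k : 'I_n => (maxn (unpair k).1 (unpair k).2).+1) (Ordinal kn).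
rewrite /= gtn_max => /andP[l1 l2].
by have /preP := e _ l1; apply.
Qed.

Lemma omega_code_surj z : (forall i, X (slice i z)) -> exists y, omega_code y = z.
Proof.
move=> Xz; pose y : Y := fun i => exist _ (slice i z) (mem_set (Xz i)).
exists y; apply/funext => k.
by rewrite /omega_code /= /slice -surjective_pairing unpairK.
Qed.

Lemma omega_code_X y i : X (slice i (omega_code y)).
Proof. by rewrite slice_omega_code; exact: set_valP. Qed.

Lemma embeds_omega_code : embeds omega_code.
Proof.
split=> [x y e|x U].
  apply: functional_extensionality_dep => i; apply: val_inj.
  by rewrite /= -slice_omega_code e slice_omega_code.
rewrite (@nbhs_prod (fun _ => X) _ x U (fun=> @embeds_set X)).
split=> -[n nU].
  pose m := \max_(i < n) projT1 (cid (slice_pre i n)).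
  exists m => y e; apply: nU => i lin.
  rewrite -!slice_omega_code; apply: (projT2 (cid (slice_pre i n))).
  apply: pre_le e.
  exact: (@leq_bigmax _ (fun i : 'I_n => projT1 (cid (slice_pre i n))) (Ordinal lin)).
have [N HN] := omega_code_pre n.
by exists N => y e; apply: nU; apply: HN.
Qed.

End omega_coding.

(** * Category arguments in the Cantor set *)

Lemma pre_lim (m : nat -> nat) (z_ : nat -> nat -> bool) :
  (forall n, (n <= m n)%N) -> (forall n, (m n <= m n.+1)%N) ->
  (forall n, pre (m n) (z_ n.+1) = pre (m n) (z_ n)) ->
  exists z, forall n, pre (m n) z = pre (m n) (z_ n).
Proof.
move=> nm mS zS.
have zle n k : pre (m n) (z_ (n + k)%N) = pre (m n) (z_ n).
  elim: k => [|k <-]; first by rewrite addn0.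
  rewrite addnS; apply: pre_le (zS _).
  by elim: k => [|k IH]; rewrite ?addn0 // addnS (leq_trans IH).
(* Bit [i] no longer changes from [z_ i.+1] on, because [i < m i.+1]. *)
exists (fun i => z_ i.+1 i) => n; apply/preP => i im.
have /preP/(_ _ im) <- := zle n i.+1.
have /preP/(_ _ (nm i.+1)) <- := zle i.+1 n.
by rewrite addnC.
Qed.

Definition clos (H : set (nat -> bool)) : set (nat -> bool) :=
  [set z | forall n, exists w, H w /\ pre n w = pre n z].

Lemma not_clos H z : ~ clos H z -> exists n, forall w, pre n w = pre n z -> ~ H w.
Proof.
by move=> /existsNP[n Hn]; exists n => w e Hw; apply: Hn; exists w.
Qed.

Lemma clos_sub H : H `<=` clos H.
Proof. by move=> z Hz n; exists z. Qed.

Lemma clos_clos H : clos (clos H) `<=` clos H.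
Proof.
by move=> z Hz n; have [w [Hw <-]] := Hz n; have [w' [Hw' <-]] := Hw n; exists w'.
Qed.

(** A Baire argument: cylinders shrink around points of [Q], the one chosen at stage [k] avoiding
    both [F k] and the point of [Q] numbered [k]. Their common point is a limit of [Q] outside [Q]
    and outside every [F k]. *)
Lemma crowded_countable_not_Gdelta (Q : set (nat -> bool))
    (F : nat -> set (nat -> bool)) :
  countable Q -> Q !=set0 ->
  (forall q n, Q q -> exists q', [/\ Q q', q' <> q & pre n q' = pre n q]) ->
  (forall k q, Q q -> ~ clos (F k) q) ->
  clos Q `<=` Q `|` \bigcup_k F k -> False.
Proof.
move=> /pcard_leTP/unsquash f [q0 Qq0] Qcr QF Qcl.
have finj q w : Q q -> Q w -> f q = f w -> q = w.
  by move=> Qq Qw; apply: (@inj _ _ _ f); rewrite inE.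
pose P (s : (nat -> bool) * nat) k (s' : (nat -> bool) * nat) :=
  [/\ Q s'.1, pre s.2 s'.1 = pre s.2 s.1, (s.2 < s'.2)%N &
    forall w, pre s'.2 w = pre s'.2 s'.1 -> ~ F k w /\ ~ (Q w /\ f w = k)].
have step s k : exists s', Q s.1 -> P s k s'.
  case: s => q n; have [Qq|nQq] := pselect (Q q); last by exists (q, n).
  have [q' [Qq' e' [m Hm]]] : exists q', [/\ Q q', pre n q' = pre n q &
      exists m, forall w, pre m w = pre m q' -> ~ (Q w /\ f w = k)].
    have [[p [Qp fp]]|np] := pselect (exists p, Q p /\ f p = k); last first.
      by exists q; split => //; exists 0%N => w _ Qw; apply: np; exists w.
    (* If the current point is the one numbered [k], crowdedness offers another in the same
       cylinder. *)
    have [q' [Qq' e' q'p]] : exists q', [/\ Q q', pre n q' = pre n q & q' <> p].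
      have [qp|qp] := pselect (q = p); last by exists q.
      by have [q' [? ? ?]] := Qcr q n Qq; exists q'; split => //; rewrite -qp.
    exists q'; split => //; have [m Hm] := pre_neq q'p.
    exists m => w we [Qw fw]; apply: Hm; rewrite -we; congr pre.
    by apply: finj; rewrite // fw.
  have [j Hj] := not_clos (QF k q' Qq').
  exists (q', (maxn n (maxn m j)).+1) => _; split=> //= [|w we].
    by rewrite ltnS leq_maxl.
  split; [apply: Hj|apply: Hm]; apply: pre_le we; apply: leqW.
    by rewrite !leq_max leqnn !orbT.
  by rewrite !leq_max leqnn !orbT.
have /choice[g gP] : forall sk : _ * nat, exists s', Q sk.1.1 -> P sk.1 sk.2 s'.
  by move=> [s k] /=.
pose st := fix st n := if n is k.+1 then g (st k, k) else (q0, 0%N).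
have stQ n : Q (st n).1.
  by elim: n => //= n IH; have [] := gP (st n, n) IH.
have stP n : P (st n) n (st n.+1) by exact: (gP (st n, n) (stQ n)).
have stn n : (n <= (st n).2)%N.
  by elim: n => // n IH; apply: leq_ltn_trans IH _; have [] := stP n.
have stl n : ((st n).2 <= (st n.+1).2)%N by have [_ _ /ltnW] := stP n.
have ste n : pre (st n).2 (st n.+1).1 = pre (st n).2 (st n).1 by have [] := stP n.
have [z zP] := pre_lim stn stl ste.
have : clos Q z by move=> n; exists (st n).1; split=> //; exact/esym/(pre_le (stn n)).
move=> /Qcl[Qz|[k _ Fz]].
  have [_ _ _ /(_ z (zP _))[_]] := stP (f z).
  by apply.
by have [_ _ _ /(_ z (zP _))[]] := stP k.
Qed.

(** Abstract in [P] so as to serve twice: for meager sets, and for sets that an F_sigma separates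
    from [X]. *)
Definition sigma_small (P : set (nat -> bool) -> Prop) (M : set (nat -> bool)) :=
  exists H : nat -> set (nat -> bool), (forall n, P (H n)) /\ M `<=` \bigcup_n H n.

Lemma sigma_small_bigcup P (J : countType) (B : J -> set (nat -> bool)) M :
  P set0 -> (forall j, sigma_small P (B j)) -> M `<=` \bigcup_j B j ->
  sigma_small P M.
Proof.
move=> P0 /choice[H HP] MB.
exists (fun n => if unpickle (unpair n).1 is Some j then H j (unpair n).2 else set0).
split=> [n|z /MB[j _ Bz]].
  by case: (unpickle _) => // j; exact: (HP j).1.
have [k _ Hk] := (HP j).2 z Bz.
by exists (pairn (pickle j, k)) => //; rewrite pairnK pickleK.
Qed.

Lemma sigma_smallS P M N : M `<=` N -> sigma_small P N -> sigma_small P M.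
Proof. by move=> MN [H [HP NH]]; exists H; split => // z /MN /NH. Qed.

Lemma sigma_small1 P M : P M -> sigma_small P M.
Proof. by move=> PM; exists (fun=> M); split => // z Mz; exists 0%N. Qed.

Definition Gdelta (X : set (nat -> bool)) : Prop :=
  exists F : nat -> set (nat -> bool), (forall k, clos (F k) `<=` F k) /\
    forall z, X z <-> forall k, ~ F k z.

Lemma prefix_cyl u v : prefix u v -> cyl v `<=` cyl u.
Proof.
move=> /prefixP[s ->] z; rewrite /cyl /= => e.
have {2}-> : u = take (size u) (u ++ s) by rewrite take_size_cat.
by rewrite -e -map_take take_iota size_cat (minn_idPl (leq_addr _ _)).
Qed.

Lemma cyl_prefix u v z : cyl u z -> cyl v z -> (size u <= size v)%N -> prefix u v.
Proof.
move=> uz vz uv; rewrite prefixE -{1}vz -map_take take_iota (minn_idPl uv).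
by apply/eqP.
Qed.

(** * Category relative to a subspace *)

Section category.
Context (X : set (nat -> bool)).

Definition meets_cyl u : Prop := exists2 x, X x & cyl u x.

(** Only cylinders that meet [X] are tested, but [H] may lie outside [X]; this gives a meaning to
    the complement of [X] being meager relative to [X]. *)
Definition nowhere_dense_in (H : set (nat -> bool)) : Prop := forall u, meets_cyl u ->
  exists v, [/\ prefix u v, meets_cyl v & forall w, cyl v w -> ~ H w].

Definition meager_in : set (nat -> bool) -> Prop := sigma_small nowhere_dense_in.

Lemma meets_cyl_pre n x : X x -> meets_cyl (pre n x).
Proof. by exists x => //; apply/cyl_pre. Qed.

Lemma nowhere_dense_in0 : nowhere_dense_in set0.
Proof. by move=> u Tu; exists u; split => // [|w _ []]; exact: prefix_refl. Qed.

Lemma avoid_finite (H : nat -> set (nat -> bool)) u k :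
  (forall n, nowhere_dense_in (H n)) -> meets_cyl u ->
  exists v, [/\ prefix u v, meets_cyl v & forall n w, (n < k)%N -> cyl v w -> ~ H n w].
Proof.
move=> ndH Tu; elim: k => [|k [v [uv Tv Hv]]].
  by exists u; split => //; exact: prefix_refl.
have [v' [vv' Tv' Hv']] := ndH k v Tv; exists v'; split => //.
  exact: prefix_trans uv vv'.
move=> n w; rewrite ltnS leq_eqVlt => /orP[/eqP ->|nk].
  exact: Hv'.
move=> /(prefix_cyl vv').
exact: (Hv _ _ nk).
Qed.

(** The Baire argument takes place in the Cantor set, as [X] is not known to be complete: the limit
    point falls into [X] because it avoids all [H n], which cover the complement. *)
Lemma avoid_meager (H : nat -> set (nat -> bool)) u :
  (forall n, nowhere_dense_in (H n)) -> ~` X `<=` \bigcup_n H n -> meets_cyl u ->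
  exists x, [/\ X x, cyl u x & forall n, ~ clos (H n) x].
Proof.
move=> ndH HX Tu.
have /choice[g gP] : forall vn : seq bool * nat, exists v', meets_cyl vn.1 ->
    [/\ prefix vn.1 v', meets_cyl v', (size vn.1 < size v')%N &
      forall w, cyl v' w -> ~ H vn.2 w].
  move=> [v n] /=; have [Tv|nTv] := pselect (meets_cyl v); last by exists v.
  have [v' [vv' [x Xx v'x] Hv']] := ndH n v Tv.
  have vx : cyl v x := prefix_cyl vv' v'x.
  pose m := maxn (size v).+1 (size v').
  have px : cyl (pre m x) x by apply/cyl_pre.
  exists (pre m x) => _; split.
  - by apply: (cyl_prefix vx px); rewrite size_pre leq_max leqnSn.
  - exact: meets_cyl_pre.
  - by rewrite size_pre leq_max ltnSn.
  - move=> w pw; apply: Hv'; apply: (prefix_cyl _ pw).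
    by apply: (cyl_prefix v'x px); rewrite size_pre leq_maxr.
pose st := fix st n := if n is k.+1 then g (st k, k) else u.
have stT n : meets_cyl (st n).
  by elim: n => //= n IH; have [] := gP (st n, n) IH.
have stP n := gP (st n, n) (stT n).
have /choice[x xP] : forall n, exists x, X x /\ cyl (st n) x.
  by move=> n; have [x] := stT n; exists x.
have [||n|z zP] := @pre_lim (fun n => size (st n)) x.
- by elim=> // n IH; apply: leq_ltn_trans IH _; have [] := stP n.
- by move=> n; have [_ _ /ltnW] := stP n.
- have [_ sx] := xP n; have [_ sx'] := xP n.+1; have [pp _ _ _] := stP n.
  by rewrite sx; exact: (prefix_cyl pp sx').
have zst n : cyl (st n) z by rewrite /cyl /= zP; exact: (xP n).2.
have zH n : ~ clos (H n) z.
  move=> /(_ (size (st n.+1)))[w [Hw we]].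
  have sw : cyl (st n.+1) w by move: (zst n.+1); rewrite /cyl /= we.
  by have [_ _ _ /(_ w sw)] := stP n.
exists z; split => //; last exact: (zst 0%N).
apply: contrapT => /HX[n _ Hz]; apply: (zH n); exact: clos_sub.
Qed.

End category.

Section suslin.
(* A Souslin scheme for the complement of [X]; [S_lim] asks more than the usual
   condition on branches, as it concerns the closures of the pieces. *)
Context (X : set (nat -> bool)) (I : countType) (S : seq I -> set (nat -> bool)).
Hypothesis S0 : S [::] = ~` X.
Hypothesis SS : forall s, S s = \bigcup_k S (rcons s k).
Hypothesis S_pre : forall s z w, S s z -> S s w -> pre (size s) z = pre (size s) w.
Hypothesis S_lim : forall (sg : nat -> seq I) z,
  (forall n, prefix (sg n) (sg n.+1)) -> (forall n, (n <= size (sg n))%N) ->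
  (forall n, exists w, S (sg n) w /\ pre n w = pre n z) -> ~ X z.

Lemma scheme_cat s t : S (s ++ t) `<=` S s.
Proof.
elim/last_ind: t => [|t k IH] z; first by rewrite cats0.
by rewrite -rcons_cat => Sz; apply: IH; rewrite SS; exists k.
Qed.

Lemma scheme_notin s z : S s z -> ~ X z.
Proof. by move=> /(@scheme_cat [::]); rewrite S0. Qed.

(** * Hurewicz's theorem *)

Section hurewicz.
(** [sigma_small away M] says that an F_sigma set disjoint from [X] covers [M]. *)
Let away (H : set (nat -> bool)) := forall x, X x -> ~ clos H x.

Let away0 : away set0.
Proof. by move=> x _ /(_ 0%N)[w []]. Qed.

(* After the pieces that an F_sigma separates from [X] are removed, whatever is
   left of [S s] accumulates at a point of [X], by [core_clos]. *)
Let core s : set (nat -> bool) :=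
  [set z | S s z /\ forall t, S t z -> ~ sigma_small away (S t)].

(** If no point of [X] were a limit of [core s], then [core s] would be away from [X]; together with
    the countably many separated pieces it covers [S s], which would then be separated too. *)
Let core_clos s : ~ sigma_small away (S s) -> exists x, X x /\ clos (core s) x.
Proof.
move=> ns; apply: contrapT => nx; apply: ns.
apply: (@sigma_small_bigcup _ (option (seq I))
  (fun o => if o is Some t then [set z | S t z /\ sigma_small away (S t)] else core s)) => //.
  move=> [t|]; last by apply: sigma_small1 => x Xx cx; apply: nx; exists x.
  have [st|nst] := pselect (sigma_small away (S t)).
    by apply: sigma_smallS st => w [].
  by apply: sigma_smallS (sigma_small1 away0) => w [].
move=> w Sw; have [[t [St sst]]|nt] := pselect (exists t, S t w /\ sigma_small away (S t)).
  by exists (Some t).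
by exists None => //; split => // t St sst; apply: nt; exists t.
Qed.

(** The second clause of [core] does not mention [s], so a point of [core s] belongs to the core of
    every piece that contains it. *)
Let core_ext s z m : core s z -> exists t, [/\ prefix s t, (m <= size t)%N & core t z].
Proof.
move=> cz; elim: m => [|m [t [pt mt [Stz ct]]]]; first by exists s; split => //; exact: prefix_refl.
move: (Stz); rewrite SS => -[k _ Sk]; exists (rcons t k); split=> //.
  by apply: prefix_trans pt _; rewrite -cats1 prefix_prefix.
by rewrite size_rcons ltnS.
Qed.

(** As [X] is no G_delta, no F_sigma separates the root piece from [X], so its core has a limit
    point in [X]. Points of the core near it are in turn approximated by points of [X]; repeating
    this grows a countable tree in [X]. *)
Theorem hurewicz : ~ Gdelta X -> exists Q : set (nat -> bool),
  [/\ countable Q, Q !=set0, Q `<=` X, X `&` clos Q `<=` Q &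
  forall q n, Q q -> exists q', [/\ Q q', q' <> q & pre n q' = pre n q]].
Proof.
move=> nG.
have nsep : ~ sigma_small away (S [::]).
  move=> [H [Ha HX]]; apply: nG; exists (fun k => clos (H k)); split.
    by move=> k; exact: clos_clos.
  move=> z; split=> [Xz k|cz]; first exact: Ha.
  apply: contrapT => nXz; have [|k _ Hz] := HX z; first by rewrite S0.
  by apply: (cz k); exact: clos_sub.
have [x0 [Xx0 cx0]] := core_clos nsep.
pose good (n : seq I * (nat -> bool)) := X n.2 /\ clos (core n.1) n.2.
(* The child numbered [k] shares at least [k] bits with its parent, so that the children converge to
   it, yet differs from it within the length of its own index. *)
pose P (n : seq I * (nat -> bool)) k (n' : seq I * (nat -> bool)) :=
  [/\ good n', prefix n.1 n'.1, (maxn k (size n.1) < size n'.1)%N,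
      pre (maxn k (size n.1)) n'.2 = pre (maxn k (size n.1)) n.2 &
      pre (size n'.1) n'.2 <> pre (size n'.1) n.2].
have /choice[g gP] : forall nk : _ * nat, exists n', good nk.1 -> P nk.1 nk.2 n'.
  move=> [[s x] k] /=.
  have [[Xx cx]|ng] := pselect (good (s, x)); last by exists (s, x).
  have [w [cw we]] := cx (maxn k (size s)).
  (* [w] lies outside [X], so it differs from [x]; a long enough index [t] around [w] passes the
     difference on to the new point [x']. *)
  have wx : w <> x by move=> wx; apply: (scheme_notin cw.1); rewrite wx.
  have [m Hm] := pre_neq wx.
  have [t [pt mt ct]] := core_ext (maxn m (maxn k (size s)).+1) cw.
  rewrite geq_max in mt; have {mt}/andP[mt st] := mt.
  have [x' [Xx' cx']] := core_clos (ct.2 _ ct.1).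
  have e' : pre (size t) x' = pre (size t) w.
    have [w' [cw' <-]] := cx' (size t); exact: S_pre cw'.1 ct.1.
  exists (t, x') => _; split => //=.
    by rewrite -we; apply: pre_le e'; apply: ltnW.
  by rewrite e' => /(pre_le mt).
(* The points of [Q] form a tree: the children of [x_r] converge to it, and the
   limits along infinite branches lie outside [X], so [Q] is closed in [X]. *)
pose node r := foldl (fun n k => g (n, k)) ([::], x0) r.
have nodeS r k : node (rcons r k) = g (node r, k) by rewrite /node foldl_rcons.
have node_good r : good (node r).
  elim/last_ind: r => // r k IH; rewrite nodeS.
  by have [] := gP (node r, k) IH.
have nodeP r k : P (node r) k (node (rcons r k)).
  by rewrite nodeS; exact: (gP (node r, k) (node_good r)).
have node_cat r r' : pre (size (node r).1) (node (r ++ r')).2 = pre (size (node r).1) (node r).2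
    /\ (size (node r).1 <= size (node (r ++ r')).1)%N.
  elim/last_ind: r' => [|r' k [IH IHs]]; first by rewrite cats0.
  rewrite -rcons_cat; have [_ _ ls e _] := nodeP (r ++ r') k.
  rewrite gtn_max in ls; have {ls}/andP[_ ls] := ls.
  split; last by apply: leq_trans IHs (ltnW ls).
  rewrite -IH; apply: pre_le e; apply: leq_trans IHs _.
  exact: leq_maxr.
exists (range (fun r => (node r).2)); split.
- exact: card_le_trans (card_image_le _ _) (countableP _).
- by exists x0; exists [::].
- by move=> _ [r _ <-]; have [] := node_good r.
- move=> z [Xz cz]; apply: contrapT => nQz.
  pose C r := pre (size (node r).1) z = pre (size (node r).1) (node r).2 /\
    forall n, exists r', pre n (node (r ++ r')).2 = pre n z.
  have Cstep r : C r -> exists k, C (rcons r k).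
    move=> [zr rz]; have [m Hm] : exists m, pre m z <> pre m (node r).2.
      by apply: pre_neq => zE; apply: nQz; exists r.
    (* Children numbered [m] or more, with their descendants, agree with the node on [m] bits and so
       stay off [z]. Finitely many children remain, and the descendants of one of them approach
       [z]. *)
    have [k km Hk] : exists2 k, (k < m)%N &
        forall n, exists r', pre n (node (rcons r k ++ r')).2 = pre n z.
      apply: contrapT => nk.
      have /choice[N HN] : forall k : nat, exists n, (k < m)%N ->
          forall r', pre n (node (rcons r k ++ r')).2 <> pre n z.
        move=> k; have [km|] := ltnP k m; last by exists 0%N.
        apply: contrapT => nn; apply: nk; exists k => // n.
        by apply: contrapT => nr; apply: nn; exists n => _ r' e; apply: nr; exists r'.
      have [r' er'] := rz (maxn m (\max_(k < m) N k)).
      case: r' er' => [|k r'] er'.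
        by apply: Hm; rewrite cats0 in er'; apply/esym; apply: pre_le er'; exact: leq_maxl.
      rewrite -cat_rcons in er'.
      have [km|mk] := ltnP k m.
        apply: (HN k km r'); apply: pre_le er'.
        rewrite leq_max; apply/orP; right.
        exact: (@leq_bigmax _ (fun k : 'I_m => N k) (Ordinal km)).
      apply: Hm; have [_ _ ls e _] := nodeP r k.
      rewrite gtn_max in ls; have {ls}/andP[ls _] := ls.
      have [e2 _] := node_cat (rcons r k) r'.
      transitivity (pre m (node (rcons r k ++ r')).2).
        by apply/esym; apply: pre_le er'; exact: leq_maxl.
      transitivity (pre m (node (rcons r k)).2).
        by apply: pre_le e2; apply: leq_trans mk (ltnW ls).
      by apply: pre_le e; rewrite leq_max mk.
    exists k; split => //.
    have [r' <-] := Hk (size (node (rcons r k)).1).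
    exact: (node_cat (rcons r k) r').1.
  have /choice[h hP] : forall r, exists k, C r -> C (rcons r k).
    move=> r; have [Cr|nC] := pselect (C r); last by exists 0%N.
    by have [k] := Cstep r Cr; exists k.
  pose rr n := iter n (fun r => rcons r (h r)) [::].
  have Crr n : C (rr n).
    elim: n => [|n IH]; last exact: hP.
    split => [|n]; first by rewrite /pre /mkseq /=.
    by have [_ [[r' _ <-] e]] := cz n; exists r'.
  have szr n : (n <= size (node (rr n)).1)%N.
    elim: n => // n IH; apply: leq_ltn_trans IH _.
    have [_ _ + _ _] := nodeP (rr n) (h (rr n)).
    by rewrite gtn_max => /andP[].
  apply: (@S_lim (fun n => (node (rr n)).1) z) => //.
    by move=> n; have [] := nodeP (rr n) (h (rr n)).
  move=> n; have [_ /(_ n)[w [cw we]]] := node_good (rr n).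
  exists w; split; first exact: cw.1.
  rewrite we; apply/esym; apply: pre_le (Crr n).1; exact: szr.
- move=> _ n [r _ <-]; have [_ _ _ e ne] := nodeP r n.
  exists (node (rcons r n)).2; split.
  + by exists (rcons r n).
  + by move=> e2; apply: ne; rewrite e2.
  + by apply: pre_le e; rewrite leq_maxl.
Qed.

End hurewicz.

(** * The Baire property of the complement *)

Section baire_property.
(* The smallest closed set containing [S s] up to a meager set. *)
Let hull s : set (nat -> bool) :=
  [set z | forall n, ~ meager_in X (S s `&` cyl (pre n z))].

Let hullN s z : ~ hull s z -> exists n, forall w, cyl (pre n z) w -> ~ hull s w.
Proof.
move=> /existsNP[n /contrapT mn]; exists n => w /cyl_pre e hw.
by apply: (hw n); rewrite e.
Qed.

Let meager0 : meager_in X set0.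
Proof. exact: sigma_small1 (@nowhere_dense_in0 X). Qed.

(** Countably many cylinders cover the points of [S s] outside the hull, and each of them meets
    [S s] in a meager set. *)
Let S_hull s : meager_in X (S s `\` hull s).
Proof.
apply: (@sigma_small_bigcup _ (seq bool) (fun u =>
  [set z | (S s `&` cyl u) z /\ meager_in X (S s `&` cyl u)])).
- exact: nowhere_dense_in0.
- move=> u; have [mu|nmu] := pselect (meager_in X (S s `&` cyl u)).
    by apply: sigma_smallS mu => z [].
  by apply: sigma_smallS meager0 => z [].
- move=> z [Sz /existsNP[n /contrapT mn]]; exists (pre n z) => //.
  by split => //; split => //; apply/cyl_pre.
Qed.

(** The union over the children of the interiors, relative to [X], of their hulls, enlarged to an
    open subset of the Cantor set. *)
Let inner s : set (nat -> bool) := [set z | exists v k, cyl v z /\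
  forall x, X x -> cyl v x -> hull (rcons s k) x].

(** If a cylinder had no suitable refinement, the hull of every child would be nowhere dense inside
    it. The part of [S s] in the cylinder would then be meager, although the cylinder contains a
    point of [hull s]. *)
Let hull_inner s : nowhere_dense_in X (hull s `\` inner s).
Proof.
move=> u Tu.
have [[v [uv Tv Hv]]|nv] := pselect (exists v, [/\ prefix u v, meets_cyl X v &
    forall w, cyl v w -> ~ hull s w]).
  by exists v; split => // w /Hv hw [].
have [[v [k [uv Tv Hv]]]|nvk] := pselect (exists v k, [/\ prefix u v, meets_cyl X v &
    forall x, X x -> cyl v x -> hull (rcons s k) x]).
  by exists v; split => // w vw [_]; apply; exists v, k.
exfalso.
have [z [uz hz]] : exists z, cyl u z /\ hull s z.
  apply: contrapT => nz; apply: nv; exists u; split => //; first exact: prefix_refl.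
  by move=> w uw hw; apply: nz; exists w.
apply: (hz (size u)); rewrite uz.
apply: (@sigma_small_bigcup _ (I * bool)%type (fun kb => if kb.2
  then S (rcons s kb.1) `\` hull (rcons s kb.1) else hull (rcons s kb.1) `&` cyl u)).
- exact: nowhere_dense_in0.
- move=> [k [|]] /=; first exact: S_hull.
  apply: sigma_small1 => u' [x' Xx' u'x'].
  have px n : cyl (pre n x') x' by apply/cyl_pre.
  pose m := maxn (size u) (size u').
  have u'm : prefix u' (pre m x').
    by apply: (cyl_prefix u'x' (px m)); rewrite size_pre leq_maxr.
  have [ux'|nux'] := pselect (cyl u x'); last first.
    exists (pre m x'); split => //; first exact: meets_cyl_pre.
    move=> w /cyl_pre we [_ uw]; apply: nux'.
    by rewrite /cyl /= -[in RHS]uw; apply/esym; apply: pre_le we; exact: leq_maxl.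
  have um : prefix u (pre m x').
    by apply: (cyl_prefix ux' (px m)); rewrite size_pre leq_maxl.
  have [x [Xx mx hx]] : exists x, [/\ X x, cyl (pre m x') x & ~ hull (rcons s k) x].
    apply: contrapT => nx; apply: nvk; exists (pre m x'), k; split => //.
      exact: meets_cyl_pre.
    by move=> x Xx mx; apply: contrapT => hx; apply: nx; exists x.
  have [n Hn] := hullN hx; exists (pre (maxn n m) x); split.
  + apply: prefix_trans u'm _; apply: (cyl_prefix mx); first by apply/cyl_pre.
    by rewrite !size_pre leq_maxr.
  + exact: meets_cyl_pre.
  + move=> w /cyl_pre we [hw _]; apply: Hn hw; apply/cyl_pre.
    by apply: pre_le we; exact: leq_maxl.
- move=> w [Sw uw]; move: (Sw); rewrite SS => -[k _ Sk].
  have [hw|hw] := pselect (hull (rcons s k) w).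
    by exists (k, false).
  by exists (k, true).
Qed.

(** Off the meager union of the sets [hull s] minus [inner s], a point of [hull [::]] follows a
    branch all of whose hulls contain it. The pieces along it come arbitrarily close, so [S_lim]
    excludes the point from [X]. *)
Let X_hull : meager_in X (X `&` hull [::]).
Proof.
apply: (@sigma_small_bigcup _ (seq I) (fun s => hull s `\` inner s)).
- exact: nowhere_dense_in0.
- by move=> s; apply: sigma_small1; exact: hull_inner.
move=> z [Xz hz]; apply: contrapT => nz.
have /choice[g gP] : forall s, exists k, hull s z -> hull (rcons s k) z.
  move=> s; have [hs|hs] := pselect (hull s z); last first.
    (* A default child is needed; if [I] were empty, so would be the root piece and its hull. *)
    have [k _] : exists k : I, True.
      apply: contrapT => nk; apply: (hz 0%N).
      apply: sigma_smallS meager0 => w []; rewrite SS => -[k _ _] _.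
      by apply: nk; exists k.
    by exists k.
  have [v [k [vz vk]]] : inner s z by apply: contrapT => ni; apply: nz; exists s.
  by exists k => _; apply: vk.
pose sg n := iter n (fun s => rcons s (g s)) [::].
have hsg n : hull (sg n) z by elim: n => // n IH; exact: gP.
apply: (@S_lim sg z) => //.
- by move=> n; rewrite /= -cats1 prefix_prefix.
- by elim=> // n IH; rewrite /= size_rcons ltnS.
- move=> n; apply: contrapT => nw; apply: (hsg n n).
  apply: sigma_smallS meager0 => w [Sw /cyl_pre we].
  by apply: nw; exists w.
Qed.

(** If the root hull is nowhere dense, the complement is meager. Otherwise the hull, being closed,
    contains the part of [X] in some cylinder, and [X_hull] makes that part meager. *)
Theorem baire_dichotomy :
  (exists2 u, meets_cyl X u & meager_in X (X `&` cyl u)) \/ meager_in X (~` X).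
Proof.
have [nd|/existsNP[u /not_implyP[Tu nu]]] := pselect (nowhere_dense_in X (hull [::])).
  right; rewrite -S0; apply: (@sigma_small_bigcup _ bool
    (fun b => if b then S [::] `\` hull [::] else hull [::])).
  + exact: nowhere_dense_in0.
  + by case; [exact: S_hull|exact: sigma_small1].
  + move=> z Sz; have [hz|hz] := pselect (hull [::] z); first by exists false.
    by exists true.
left; exists u => //; apply: sigma_smallS X_hull => x [Xx ux]; split => //.
apply: contrapT => /hullN[n Hn]; apply: nu.
exists (pre (maxn n (size u)) x); split.
- by apply: (cyl_prefix ux); [apply/cyl_pre|rewrite size_pre leq_maxr].
- exact: meets_cyl_pre.
- move=> w /cyl_pre we; apply: Hn; apply/cyl_pre; apply: pre_le we.
  exact: leq_maxl.
Qed.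

End baire_property.
End suslin.

(** * Polish and analytic subspaces of the Cantor set *)

Lemma dense_nbhs (T : topologicalType) (D : set T) (x : T) (U : set T) :
  dense D -> nbhs x U -> exists2 y, D y & U y.
Proof.
move=> dD; rewrite nbhsE => -[V [oV Vx] VU].
have [|y [Vy Dy]] := dD V _ oV; first by exists x.
by exists y => //; exact: VU.
Qed.

Lemma countable_range (I : countType) (T : Type) (e : I -> T) : countable (range e).
Proof. exact: card_le_trans (card_image_le _ _) (countableP _). Qed.

(** One point is chosen for each cylinder that meets the image. Letting [P] depend on the number of
    the cylinder allows requirements that grow along the enumeration. *)
Lemma embeds_dense (T : topologicalType) (c : T -> nat -> bool) (t0 : T)
    (P : nat -> T -> Prop) : embeds c ->
  (forall n k t, exists t', pre n (c t') = pre n (c t) /\ P k t') ->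
  exists2 e : seq bool -> T, dense (range e) & forall u, P (pickle u) (e u).
Proof.
move=> [_ cn] HP.
have /choice[e eP] : forall u, exists t,
    ((exists t', cyl u (c t')) -> cyl u (c t)) /\ P (pickle u) t.
  move=> u; have [[t' ut']|nt] := pselect (exists t', cyl u (c t')).
    have [t [te Pt]] := HP (size u) (pickle u) t'; exists t; split=> // _.
    by rewrite /cyl /= te.
  by have [t [_ Pt]] := HP 0%N (pickle u) t0; exists t.
exists e; last by move=> u; have [] := eP u.
move=> O [x Ox] oO; have /cn[n nO] : nbhs x O by exact: open_nbhs_nbhs.
exists (e (pre n (c x))); split; last by exists (pre n (c x)).
apply: nO; apply/cyl_pre; have [+ _] := eP (pre n (c x)); apply.
by exists x; apply/cyl_pre.
Qed.

Lemma embeds_separable (T : topologicalType) (c : T -> nat -> bool) :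
  embeds c -> separable_space T.
Proof.
move=> cE; have [[t _]|nt] := pselect (exists t : T, True); last first.
  by exists set0; [exact: countable0|move=> O [x]; case: nt; exists x].
have [|e de _] := @embeds_dense T c t (fun _ _ => True) cE.
  by move=> n _ t'; exists t'.
by exists (range e) => //; exact: countable_range.
Qed.

(** * Complete metrics from sequences of partitions *)

Section inverse_nat.
Context {R : realType}.
Local Open Scope ring_scope.
Definition inv_succ (n : nat) : R := n.+1%:R^-1.

Lemma inv_succ_gt0 n : 0 < inv_succ n. Proof. by rewrite invr_gt0 ltr0n. Qed.

Lemma inv_succ_lt m n : (inv_succ m < inv_succ n) = (n < m)%N.
Proof. by rewrite ltf_pV2 ?posrE ?ltr0n // ltr_nat ltnS. Qed.

Lemma inv_succ_arch (e : R) : 0 < e -> exists n, inv_succ n < e.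
Proof.
move=> e0; have e1 : 0 <= e^-1 by rewrite invr_ge0 ltW.
have lt := archi_boundP e1; exists (Num.Def.archi_bound e^-1).
rewrite invf_plt ?posrE ?ltr0n //; apply: lt_le_trans lt _.
by rewrite ler_nat.
Qed.

Lemma inv_succ_split n : exists m, inv_succ m + inv_succ m < inv_succ n.
Proof.
have [|m em] := @inv_succ_arch (inv_succ n / 2%:R).
  by rewrite divr_gt0 ?inv_succ_gt0 ?ltr0n.
by exists m; rewrite [ltRHS](splitr (inv_succ n)) ltrD.
Qed.

Lemma cvg_eventually (T : topologicalType) (s : nat -> T) (l : T)
    (U : set T) : s @ \oo --> l -> nbhs l U -> exists N, forall n, (N <= n)%N -> U (s n).
Proof. by move=> sl /sl[N _ NU]; exists N => n /NU. Qed.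

Lemma cauchy_inv_succ (T : topologicalType) (d : T -> T -> R) (s : nat -> T) :
  (forall k, exists N, forall m n, (N <= m)%N -> (N <= n)%N -> d (s m) (s n) < inv_succ k) ->
  cauchy_seq d s.
Proof.
move=> H e /inv_succ_arch[k ke]; have [N HN] := H k.
by exists N => m n Nm Nn; apply: lt_trans (HN _ _ Nm Nn) ke.
Qed.

(** The labels define finer and finer partitions; distinct points are at distance 1/(N+1) for the
    first [N] at which their labels differ. Every label stabilises along a Cauchy sequence. *)
Lemma polish_label (T : topologicalType) (C : Type) (lab : nat -> T -> C) :
  separable_space T ->
  (forall n x y, lab n.+1 x = lab n.+1 y -> lab n x = lab n y) ->
  (forall x y, (forall n, lab n x = lab n y) -> x = y) ->
  (forall x U, nbhs x U <-> exists n, forall y, lab n y = lab n x -> U y) ->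
  (forall s : nat -> T,
    (forall n, exists N, forall i, (N <= i)%N -> lab n (s i) = lab n (s N)) ->
    exists l, forall n, exists N, forall i, (N <= i)%N -> lab n (s i) = lab n l) ->
  polish R T.
Proof.
move=> sep labS lab_inj labN lab_lim; split=> //.
have lab_le m n x y : (m <= n)%N -> lab n x = lab n y -> lab m x = lab m y.
  move=> mn; elim: n mn => [|n IH]; first by rewrite leqn0 => /eqP ->.
  by rewrite leq_eqVlt => /orP[/eqP -> //|/IH {}IH /labS].
have /choice[N NP] : forall xy : T * T, exists n, xy.1 <> xy.2 ->
    lab n xy.1 <> lab n xy.2 /\ forall i, (i < n)%N -> lab i xy.1 = lab i xy.2.
  move=> [x y] /=; have [->|xy] := pselect (x = y); first by exists 0%N.
  have [|m lm mP] := @ex_least (fun n => lab n x <> lab n y).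
    apply: contrapT => /forallNP nn; apply: xy; apply: lab_inj => n.
    by apply: contrapT; exact: nn.
  exists m => _; split => // i im; apply: contrapT => /mP.
  by rewrite leqNgt im.
pose d x y := if pselect (x = y) is left _ then 0 else inv_succ (N (x, y)).
have dlt n x y : d x y < inv_succ n <-> lab n x = lab n y.
  rewrite /d; case: pselect => [->|xy]; first by split=> // _; exact: inv_succ_gt0.
  have [/= nl leq] := NP (x, y) xy; rewrite inv_succ_lt; split; first exact: leq.
  by move=> e; rewrite ltnNge; apply/negP => /lab_le/(_ e).
have d0 x y : 0 <= d x y.
  by rewrite /d; case: pselect => // _; exact/ltW/inv_succ_gt0.
have dE x y : d x y = 0 <-> x = y.
  rewrite /d; case: pselect => // xy; split=> // e.
  by have := inv_succ_gt0 (N (x, y)); rewrite e ltxx.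
have deps x y : x <> y -> d x y = inv_succ (N (x, y)) by rewrite /d; case: pselect.
have dC' x y : d x y <= d y x.
  have [->//|xy] := pselect (x = y); rewrite leNgt; apply/negP.
  rewrite (deps x y) // => /dlt e.
  by have [/= ] := NP (x, y) xy; rewrite e.
exists d; split.
- split=> //; first by move=> x y; apply: le_anti; rewrite !dC'.
  move=> x y z; have [->|xz] := pselect (x = z); first by rewrite (dE z z).2 // addr_ge0.
  have [/= nl _] := NP (x, z) xz; rewrite leNgt; apply/negP => lt; apply: nl.
  rewrite (deps x z) // in lt.
  transitivity (lab (N (x, z)) y); apply/dlt; apply: le_lt_trans lt.
    by rewrite lerDl.
  by rewrite lerDr.
- move=> x U; rewrite labN; split=> [[n nU]|[e /inv_succ_arch[n ne] eU]].
    by exists (inv_succ n); [exact: inv_succ_gt0|move=> y /= /dlt /esym /nU].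
  by exists n => y /esym/dlt dxy; apply: eU; exact: lt_trans ne.
- move=> s cs; have [|l lP] := lab_lim s.
    move=> n; have [M MP] := cs _ (inv_succ_gt0 n); exists M => i Mi.
    by apply/dlt; exact: MP.
  exists l => U /labN[n nU]; have [M MP] := lP n.
  by exists M => // i /= Mi; apply: nU; exact: MP.
Qed.

End inverse_nat.

(** [lev n x] is the least length, at least [n], of a prefix of [x] whose cylinder misses the first
    [n] closed sets. The last clause is completeness in combinatorial form: a point matching such
    prefixes for all [n] misses every closed set. *)
Lemma Gdelta_level (X : set (nat -> bool)) : Gdelta X ->
  exists lev : nat -> (nat -> bool) -> nat,
  [/\ forall n x, X x -> (n <= lev n x)%N,
      forall n x, X x -> (lev n x <= lev n.+1 x)%N,
      forall n x w, X x -> pre (lev n x) w = pre (lev n x) x -> lev n w = lev n x &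
      forall z, (forall n, exists2 x, X x & pre (lev n x) z = pre (lev n x) x) -> X z].
Proof.
move=> [F [Fcl XF]].
pose ok n u := (n <= size u)%N /\ forall k, (k < n)%N -> forall z, cyl u z -> ~ F k z.
have okS n u : ok n.+1 u -> ok n u.
  by move=> [nu uF]; split; [exact: ltnW|move=> k /leqW/uF].
have /choice[lev levP] : forall nz : nat * (nat -> bool), exists m,
    (exists m, ok nz.1 (pre m nz.2)) ->
    ok nz.1 (pre m nz.2) /\ forall j, (j < m)%N -> ~ ok nz.1 (pre j nz.2).
  move=> [n z] /=; have [okm|nok] := pselect (exists m, ok n (pre m z)); last by exists 0%N.
  have [m lm mP] := ex_least okm.
  by exists m => _; split => // j jm /mP; rewrite leqNgt jm.
have exok n x : X x -> exists m, ok n (pre m x).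
  move=> /XF nF; have /choice[h hP] : forall k, exists m, forall w, pre m w = pre m x -> ~ F k w.
    by move=> k; apply: not_clos => /Fcl; exact: nF.
  exists (maxn n (\max_(k < n) h k)); split; first by rewrite size_pre leq_maxl.
  move=> k kn z /cyl_pre e; apply: hP; apply: pre_le e.
  rewrite leq_max; apply/orP; right.
  exact: (@leq_bigmax _ (fun k : 'I_n => h k) (Ordinal kn)).
have levX n x (Xx : X x) := levP (n, x) (exok n x Xx).
exists (fun n z => lev (n, z)); split.
- by move=> n x /(levX n)[[+ _] _]; rewrite size_pre.
- move=> n x Xx; rewrite leqNgt; apply/negP => lt.
  have [_ /(_ _ lt)] := levX n x Xx; apply; apply: okS.
  by have [] := levX n.+1 x Xx.
- move=> n x w Xx e; have [okx lx] := levX n x Xx.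
  have [|/= okw lw] := levP (n, w); first by exists (lev (n, x)); rewrite /= e.
  have [lt|lt|//] := ltngtP (lev (n, w)) (lev (n, x)); exfalso.
    by apply: (lx _ lt); rewrite /= -(pre_le (ltnW lt) e).
  by apply: (lw _ lt); rewrite e.
- move=> z zP; apply/XF => k; have [x Xx e] := zP k.+1.
  have [[_ okx] _] := levX k.+1 x Xx; apply: (okx k (ltnSn k)).
  exact/cyl_pre.
Qed.

(** * Polish subspaces as G_delta sets, and schemes for analytic sets *)

Section polish.
Context {R : realType}.
Local Open Scope ring_scope.

Theorem Gdelta_polish (X : set cantor_space) : Gdelta X -> polish R X.
Proof.
move=> /Gdelta_level[lev [lev_ge levS lev_eq lev_lim]].
have VX (x : X) : X (\val x) by exact: set_valP.
have [vinj vnbhs] := @embeds_set X.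
pose lab n (x : X) := pre (lev n (\val x)) (\val x).
have labE n (x y : X) : lab n x = lab n y -> lev n (\val x) = lev n (\val y).
  by move=> /(congr1 size); rewrite !size_pre.
have labP n (x y : X) : lab n y = lab n x <->
    pre (lev n (\val x)) (\val y) = pre (lev n (\val x)) (\val x).
  split=> [e|e]; first by rewrite -{1}(labE _ _ _ e).
  by rewrite /lab (lev_eq _ _ _ (VX x) e).
apply: (@polish_label _ _ _ lab).
- exact: (embeds_separable (@embeds_set X)).
- by move=> n x y /labP e; apply/labP; apply: pre_le e; exact: levS.
- move=> x y e; apply: vinj; apply: pre_inj => n.
  by have /esym/labP := e n; move=> /(pre_le (lev_ge _ _ (VX x))).
- move=> x U; rewrite vnbhs; split=> -[n nU].
    by exists n => y /labP /(pre_le (lev_ge _ _ (VX x))); exact: nU.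
  by exists (lev n (\val x)) => y /labP; exact: nU.
- move=> s /choice[N NP].
  pose M n := \max_(k < n.+1) N k.
  have NM n : (N n <= M n)%N by exact: (@leq_bigmax _ (fun k : 'I_n.+1 => N k) ord_max).
  have MS n : (M n <= M n.+1)%N by rewrite /M [leqRHS]big_ord_recr leq_maxl.
  have labM n i : (M n <= i)%N -> lab n (s i) = lab n (s (M n)).
    by move=> Mi; rewrite NP ?(leq_trans (NM n)) // [RHS]NP.
  have [| |n|z zP] := @pre_lim (fun n => lev n (\val (s (M n)))) (fun n => \val (s (M n))).
  + by move=> n; exact: lev_ge.
  + move=> n; rewrite -(labE _ _ _ (labM n (M n.+1) (MS n))).
    exact: levS.
  + by apply/labP; exact: labM.
  have Xz : X z by apply: lev_lim => n; exists (\val (s (M n))).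
  exists (exist _ z (mem_set Xz)) => n; exists (M n) => i Mi.
  by rewrite labM //; apply/esym/labP; rewrite /= zP.
Qed.

(** The open set [O k] holds the points with a cylinder in which [X] is nonempty and has small
    diameter. Around a point of all [O k], points of [X] form a Cauchy sequence, whose limit is that
    point because [k <= m] makes the cylinders shrink. *)
Theorem polish_Gdelta (X : set cantor_space) : polish R X -> Gdelta X.
Proof.
move=> [_ [d [[d0 dE dC dT] dN dcomp]]].
have VX (x : X) : X (\val x) by exact: set_valP.
have [vinj vnbhs] := @embeds_set X.
pose O k z := exists2 m, (k <= m)%N & (exists x : X, pre m (\val x) = pre m z) /\
  forall x y : X, pre m (\val x) = pre m z -> pre m (\val y) = pre m z -> d x y < inv_succ k.
have OX k z : X z -> O k z.
  move=> Xz; pose x : X := exist _ z (mem_set Xz).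
  have [m em] := @inv_succ_split R k.
  have /vnbhs[n nU] : nbhs x [set y | d x y < inv_succ m].
    by apply/dN; exists (inv_succ m) => //; exact: inv_succ_gt0.
  exists (maxn k n); first exact: leq_maxl.
  split; first by exists x.
  move=> y y' /(pre_le (leq_maxr k n)) ye /(pre_le (leq_maxr k n)) y'e.
  apply: le_lt_trans (dT _ x _) _; apply: lt_trans em.
  by apply: ltrD; [rewrite dC|]; apply: nU.
exists (fun k => ~` O k); split.
  move=> k z cz [m km [[x xz] mO]]; have [w [nO we]] := cz m; apply: nO.
  exists m => //; split; first by exists x; rewrite we.
  by move=> y y'; rewrite we; exact: mO.
move=> z; split=> [Xz k|Oz]; first by move=> nO; apply: nO; exact: OX.
have {}Oz k : O k z by apply: contrapT; exact: Oz.
have /choice[h hP] : forall k, exists m, [/\ (k <= m)%N, (exists x : X, pre m (\val x) = pre m z) &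
    forall x y : X, pre m (\val x) = pre m z -> pre m (\val y) = pre m z -> d x y < inv_succ k].
  by move=> k; have [m km [? ?]] := Oz k; exists m.
have /choice[s sP] : forall n, exists x : X, pre (\max_(k < n.+1) h k) (\val x) = pre (\max_(k < n.+1) h k) z.
  move=> n; have [km [x xe] _] := hP (\max_(k < n.+1) h k).
  by exists x; exact: pre_le xe.
have sh k n : (k <= n)%N -> pre (h k) (\val (s n)) = pre (h k) z.
  move=> kn; apply: pre_le (sP n).
  exact: (@leq_bigmax _ (fun k : 'I_n.+1 => h k) (Ordinal (kn : (k < n.+1)%N))).
have sC : cauchy_seq d s.
  apply: cauchy_inv_succ => k; exists k => m n km kn.
  by have [_ _] := hP k; apply; exact: sh.
have [l sl] := dcomp s sC.
rewrite (_ : z = \val l) //; apply: pre_inj => n.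
have nl : nbhs l [set y : X | pre n (\val y) = pre n (\val l)] by apply/vnbhs; exists n.
have [N NP] := cvg_eventually sl nl.
rewrite -(NP (maxn n N)) ?leq_maxr //.
have [nh _ _] := hP n.
by apply/esym; apply: pre_le nh _; apply: sh; exact: leq_maxl.
Qed.

(** Entry [i] of an index records a nearby point of the dense set and the first [i.+1] bits of the
    image. The bits make the pieces small; the shared dense points make preimages chosen along a
    branch Cauchy, even if [z] is only a limit of the pieces. *)
Theorem analytic_scheme (A : set cantor_space) : analytic R A ->
  exists S : seq (nat * seq bool) -> set (nat -> bool),
  [/\ S [::] = A, forall s, S s = \bigcup_k S (rcons s k),
      forall s z w, S s z -> S s w -> pre (size s) z = pre (size s) w &
      forall (sg : nat -> seq (nat * seq bool)) z,
        (forall n, prefix (sg n) (sg n.+1)) -> (forall n, (n <= size (sg n))%N) ->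
        (forall n, exists w, S (sg n) w /\ pre n w = pre n z) -> A z].
Proof.
move=> [P [f [[[D /pcard_leTP/unsquash g dD] [d [[d0 dE dC dT] dN dcomp]]] fc fA]]].
have ginj q q' : D q -> D q' -> g q = g q' -> q = q'.
  by move=> Dq Dq'; apply: (@inj _ _ _ g); rewrite inE.
pose B i (k : nat * seq bool) p :=
  pre i.+1 (f p) = k.2 /\ exists q, [/\ D q, g q = k.1 & d p q < inv_succ i].
have B_ex i p : exists k, B i k p.
  have [|q Dq pq] := @dense_nbhs _ D p [set y | d p y < inv_succ i] dD.
    by apply/dN; exists (inv_succ i) => //; exact: inv_succ_gt0.
  by exists (g q, pre i.+1 (f p)); split => //; exists q.
pose S s : set (nat -> bool) := [set z | exists p, f p = z /\
  forall i, (i < size s)%N -> B i (nth (0%N, [::]) s i) p].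
exists S; split.
- rewrite -fA; apply/seteqP; split=> z; first by move=> [p [<- _]]; exists p.
  by move=> [p _ <-]; exists p.
- move=> s; apply/seteqP; split=> z.
    move=> [p [fp Bp]]; have [k Bk] := B_ex (size s) p; exists k => //.
    exists p; split => // i; rewrite size_rcons ltnS leq_eqVlt nth_rcons.
    by move=> /orP[/eqP ->|lt]; [rewrite ltnn eqxx|rewrite lt; exact: Bp].
  move=> [k _ [p [fp Bp]]]; exists p; split => // i lt.
  have := Bp i; rewrite size_rcons ltnS nth_rcons lt; apply; exact: ltnW.
- move=> s z w [p [<- Bp]] [q [<- Bq]]; case: (size s) Bp Bq => // n Bp Bq.
  by rewrite (Bp n (ltnSn n)).1 (Bq n (ltnSn n)).1.
- move=> sg z sg_prefix sg_size sg_z.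
  have /choice[p pP] : forall n, exists p, pre n (f p) = pre n z /\
      forall i, (i < size (sg n))%N -> B i (nth (0%N, [::]) (sg n) i) p.
    by move=> n; have [_ [[p [<- Bp]] e]] := sg_z n; exists p.
  have sg_nth n m i : (i < size (sg n))%N -> (n <= m)%N ->
      nth (0%N, [::]) (sg m) i = nth (0%N, [::]) (sg n) i /\ (i < size (sg m))%N.
    move=> lt; elim: m => [|m IH]; first by rewrite leqn0 => /eqP <-.
    rewrite leq_eqVlt => /orP[/eqP <- //|/IH[<- lm]].
    have /prefixP[t ->] := sg_prefix m; rewrite nth_cat lm size_cat; split=> //.
    exact: ltn_addr.
  have pC : cauchy_seq d p.
    apply: cauchy_inv_succ => k; have [i ik] := @inv_succ_split R k.
    have li : (i < size (sg i.+1))%N := sg_size i.+1.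
    exists i.+1 => m n im inn.
    have [em lm] := sg_nth _ _ _ li im; have [en ln] := sg_nth _ _ _ li inn.
    have [_ [q [Dq gq mq]]] := (pP m).2 i lm.
    have [_ [q' [Dq' gq' nq']]] := (pP n).2 i ln.
    have qq : q = q' by apply: ginj => //; rewrite gq gq' em en.
    apply: le_lt_trans (dT _ q _) _; apply: lt_trans ik.
    by apply: ltrD => //; rewrite dC qq.
  have [l pl] := dcomp p pC.
  rewrite -fA; exists l => //; apply: pre_inj => n.
  have nf : nbhs (f l) [set w | pre n w = pre n (f l)].
    by apply/embeds_cantor.2; exists n.
  have [N NP] := cvg_eventually pl (fc l _ nf).
  rewrite -(NP (maxn n N)) ?leq_maxr //=.
  by apply: pre_le (pP _).1; exact: leq_maxl.
Qed.

End polish.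

(** * Homogeneity of powers of Polish spaces *)

Section scheme.
Context (T : topologicalType) (J : eqType) (j0 : J) (piece : nat -> set T -> Prop).
Hypothesis piece0 : piece 0 setT.
Hypothesis piece_split : forall n P, piece n P -> exists Q : J -> set T,
  [/\ forall j, piece n.+1 (Q j), forall j, Q j `<=` P,
      forall x, P x -> exists j, Q j x & forall j j' x, Q j x -> Q j' x -> j = j'].
Hypothesis piece_open : forall n P, piece n P -> P !=set0 /\ open P.
Hypothesis piece_cap : forall P : nat -> set T, (forall n, piece n (P n)) ->
  (forall n, P n.+1 `<=` P n) ->
  [/\ exists x, forall n, P n x,
      forall x y, (forall n, P n x) -> (forall n, P n y) -> x = y &
      forall x U, (forall n, P n x) -> nbhs x U -> exists n, P n `<=` U].

(** A transposition of labels renames the child containing [a] to [j0]. *)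
Let piece_split_at n P a : piece n P -> P a -> exists Q : J -> set T,
  [/\ forall j, piece n.+1 (Q j), forall j, Q j `<=` P,
      forall x, P x -> exists j, Q j x & forall j j' x, Q j x -> Q j' x -> j = j'] /\
  Q j0 a.
Proof.
move=> /piece_split[Q [QP QS Qcov Qdis]] /[dup] Pa /Qcov[j1 Qa].
pose sw j := if j == j0 then j1 else if j == j1 then j0 else j.
have swK j : sw (sw j) = j.
  rewrite /sw; have [->|jj0] := eqVneq j j0.
    by rewrite eqxx; have [-> //|] := eqVneq j1 j0.
  have [->|jj1] := eqVneq j j1; first by rewrite eqxx.
  by rewrite (negbTE jj0) (negbTE jj1).
exists (fun j => Q (sw j)); split; last by rewrite /sw eqxx.
split=> //.
  by move=> x /Qcov[j Qj]; exists (sw j); rewrite swK.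
by move=> j j' x Qj Qj'; rewrite -(swK j) (Qdis _ _ _ Qj Qj') swK.
Qed.

(** Along a tail of [j0] the mark is kept, so it lies in all the pieces and is the point itself. If
    [x] in [A] had infinitely many other indices, the numbers of the marks on its branch would be
    unbounded, whereas minimality bounds them by [g x]. *)
Lemma scheme_coding (A : set T) : countable A -> dense A ->
  exists h : T -> nat -> J, [/\ bijective h,
    forall x U, nbhs x U <-> exists n, forall y, (forall i, (i < n)%N -> h y i = h x i) -> U y &
    forall x, A x <-> exists n, forall i, (n <= i)%N -> h x i = j0].
Proof.
move=> /pcard_leTP/unsquash g dA.
have ginj a b : A a -> A b -> g a = g b -> a = b.
  by move=> Aa Ab; apply: (@inj _ _ _ g); rewrite inE.
pose good n (s : set T * T) := [/\ piece n s.1, A s.2 & s.1 s.2].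
pose minimal (s : set T * T) := forall a, A a -> s.1 a -> (g s.2 <= g a)%N.
(* The child [j0] inherits the marked point; every other child is marked by its
   point of [A] of least index, so every point of [A] is marked eventually. *)
have /choice[step0 step0P] : forall ns : nat * (set T * T), exists f : J -> set T * T,
    good ns.1 ns.2 -> [/\ forall j, good ns.1.+1 (f j), forall j, (f j).1 `<=` ns.2.1,
      forall x, ns.2.1 x -> exists j, (f j).1 x,
      forall j j' x, (f j).1 x -> (f j').1 x -> j = j' &
      (f j0).2 = ns.2.2 /\ forall j, j <> j0 -> minimal (f j)].
  move=> [n [P a]] /=; have [[/= PP Aa Pa]|ng] := pselect (good n (P, a)); last first.
    by exists (fun=> (P, a)).
  have [Q [[QP QS Qcov Qdis] Qa]] := piece_split_at PP Pa.
  have /choice[m mP] : forall j, exists b, [/\ A b, Q j b & forall b', A b' -> Q j b' -> (g b <= g b')%N].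
    move=> j; have [[x Qx] Qo] := piece_open (QP j).
    have [|k [b [Ab Qb gb]] kmin] := @ex_least (fun k => exists b, [/\ A b, Q j b & g b = k]).
      have [b Ab Qb] := dense_nbhs dA (open_nbhs_nbhs (conj Qo Qx)).
      by exists (g b), b.
    by exists b; split=> // b' Ab' Qb'; rewrite gb; apply: kmin; exists b'.
  exists (fun j => (Q j, if j == j0 then a else m j)) => _; split=> //=.
    by move=> j; split=> //=; case: eqP => [e|_]; rewrite ?e //; have [] := mP j.
  rewrite eqxx; split=> // j /eqP/negbTE -> b Ab /= Qb.
  by have [_ _] := mP j; apply.
pose step n s j := step0 (n, s) j.
have stepP n s := step0P (n, s).
have [a0 Aa0] : exists a, A a.
  have [[x _] _] := piece_open piece0.
  by have [a Aa _] := dense_nbhs dA (@filterT _ (nbhs x) _); exists a.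
pose node (b : nat -> J) := fix node n := if n is k.+1 then step k (node k) (b k) else (setT, a0).
have node_good b n : good n (node b n).
  by elim: n => [//|n IH] /=; have [+ _ _ _ _] := stepP n _ IH; apply.
have nodeS b n : (node b n.+1).1 `<=` (node b n).1.
  by have [_ + _ _ _] := stepP n _ (node_good b n); apply.
have node_ext b b' n : (forall i, (i < n)%N -> b i = b' i) -> node b n = node b' n.
  elim: n => // n IH e /=; rewrite IH ?e // => i lt; apply: e; exact: ltnW.
have node_cap b := @piece_cap (fun n => (node b n).1)
  (fun n => let: And3 p _ _ := node_good b n in p) (nodeS b).
have /choice[h hP] : forall x, exists b, forall n, (node b n).1 x.
  move=> x; have /choice[jx jxP] : forall ns : nat * (set T * T), exists j,
      good ns.1 ns.2 -> ns.2.1 x -> (step ns.1 ns.2 j).1 x.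
    move=> [n s] /=; have [[gs sx]|ng] := pselect (good n s /\ s.1 x); last first.
      by exists j0 => gs sx; case: ng.
    by have [_ _ /(_ x sx)[j jP] _ _] := stepP n s gs; exists j.
  pose st := fix st n := if n is k.+1 then step k (st k) (jx (k, st k)) else (setT, a0).
  exists (fun n => jx (n, st n)) => n.
  have -> : node (fun n => jx (n, st n)) n = st n by elim: n => //= n ->.
  have [] : good n (st n) /\ (st n).1 x; last by [].
  elim: n => [|n [gn sx]]; first by split=> //; split.
  split; last exact: (jxP (n, st n)).
  by have [+ _ _ _ _] := stepP n _ gn; apply.
have node_h b n x : (node b n).1 x -> forall i, (i < n)%N -> h x i = b i.
  elim: n => // n IH nx; have {}IH := IH (nodeS _ _ _ nx).
  move=> i; rewrite ltnS leq_eqVlt => /orP[/eqP ->|]; last exact: IH.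
  have [_ _ _ dis _] := stepP n _ (node_good b n).
  apply: (dis _ _ x); last exact: nx.
  by have := hP x n.+1; rewrite /= (node_ext _ b).
exists h; split.
- have /choice[k kP] : forall b, exists x, forall n, (node b n).1 x.
    by move=> b; have [] := node_cap b.
  exists k => [x|b]; first by have [_ + _] := node_cap (h x); apply.
  by apply/funext => i; apply: (@node_h b i.+1).
- move=> x U; split=> [xU|[n nU]].
    have [_ _ /(_ x U (hP x) xU)[n nU]] := node_cap (h x).
    exists n => y e; apply: nU; rewrite -(node_ext (h y)) //; exact: hP.
  have [Pn _ _] := node_good (h x) n; have [_ oP] := piece_open Pn.
  apply: (@filterS _ (nbhs x) _ _ _ _ (open_nbhs_nbhs (conj oP (hP x n)))).
  by move=> y /node_h; exact: nU.
- move=> x; split=> [Ax|[n nj0]].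
    apply: contrapT => nn.
    have {}nn n : exists2 i, (n <= i)%N & h x i <> j0.
      apply: contrapT => ni; apply: nn; exists n => i lt.
      by apply: contrapT => hi; apply: ni; exists i.
    pose mk n := (node (h x) n).2; pose mn n := minimal (node (h x) n).
    have mn_step n : h x n <> j0 -> mn n.+1.
      by have [_ _ _ _ [_]] := stepP n _ (node_good (h x) n); apply.
    have mk_j0 n : h x n = j0 -> mk n.+1 = mk n.
      by rewrite /mk /= => ->; have [_ _ _ _ []] := stepP n _ (node_good (h x) n).
    have mnS n : mn n -> mn n.+1 /\ (g (mk n) <= g (mk n.+1))%N.
      move=> mnn; have [hj|/mn_step ?] := pselect (h x n = j0); last first.
        split=> //; apply: mnn; first by have [] := node_good (h x) n.+1.
        by apply: nodeS; have [] := node_good (h x) n.+1.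
      rewrite mk_j0 //; split=> // a Aa na; rewrite -/(mk n.+1) mk_j0 //.
      by apply: mnn => //; exact: nodeS na.
    have mn_le n i : mn n -> (n <= i)%N -> mn i /\ (g (mk n) <= g (mk i))%N.
      move=> mnn; elim: i => [|i IH]; first by rewrite leqn0 => /eqP <-.
      rewrite leq_eqVlt => /orP[/eqP <- //|/IH[/mnS[? lt] lt']]; split=> //.
      exact: leq_trans lt.
    have big k : exists2 n, mn n & (k <= g (mk n))%N.
      elim: k => [|k [n mnn kn]].
        by have [i _ /mn_step] := nn 0%N; exists i.+1.
      have [i ni hi] := nn n; have [mni lt] := mn_le _ _ mnn ni.
      have [mni1 lt1] := mnS _ mni; exists i.+1 => //.
      (* The number grows strictly: a mark kept at an index other than [j0] would lie in two
         disjoint children. *)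
      apply: (leq_ltn_trans (leq_trans kn lt)); rewrite ltn_neqAle lt1 andbT.
      apply/negP => /eqP e; apply: hi.
      have [_ Ai Pi] := node_good (h x) i; have [_ Ai1 Pi1] := node_good (h x) i.+1.
      have mke : mk i = mk i.+1 by apply: ginj.
      have [gs _ _ dis [ej0 _]] := stepP i _ (node_good (h x) i).
      apply: (dis _ _ (mk i.+1)); first exact: Pi1.
      by rewrite -mke -[mk i]ej0; have [] := gs j0.
    have [n mnn] := big (g x).+1; rewrite ltnNge => /negP; apply.
    exact: mnn.
  have [_ + _] := node_cap (h x) => /(_ x (node (h x) n).2 (hP x)) ->.
    by have [] := node_good (h x) n.
  move=> i; have [ni|/ltnW lt] := leqP n i; last first.
    have [_ _] := node_good (h x) n; move: (node (h x) n).2 => a; rewrite -(subnK lt).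
    by elim: (n - i)%N => [//|m IH nm]; apply: IH; rewrite addSn in nm; exact: nodeS nm.
  have -> : (node (h x) n).2 = (node (h x) i).2.
    elim: i ni => [|i IH]; first by rewrite leqn0 => /eqP ->.
    rewrite leq_eqVlt => /orP[/eqP <- //|lt]; rewrite IH //=.
    by rewrite nj0 //; have [_ _ _ _ [->]] := stepP i _ (node_good (h x) i).
  by have [] := node_good (h x) i.
Qed.

Lemma scheme_cdh : countable_dense_homogeneous T.
Proof.
move=> A B cA dA cB dB.
have [hA [[kA hAK kAK] hAn hAA]] := scheme_coding cA dA.
have [hB [[kB hBK kBK] hBn hBB]] := scheme_coding cB dB.
exists (kB \o hA).
  exists (kA \o hB); split => [x|x|x U|x U] /=.
  - by rewrite kBK hAK.
  - by rewrite kAK hBK.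
  - move=> /hBn[n nU]; apply/hAn; exists n => y e.
    by apply: nU => /= i lt; rewrite !kBK; exact: e.
  - move=> /hAn[n nU]; apply/hBn; exists n => y e.
    by apply: nU => /= i lt; rewrite !kAK; exact: e.
apply/seteqP; split=> [_ [x Ax <-]|y By].
  by apply/hBB; rewrite /= kBK; exact/hAA.
exists (kA (hB y)); last by rewrite /= kAK hBK.
by apply/hAA; rewrite kAK; exact/hBB.
Qed.

End scheme.

(** * Schemes on the power, compact and noncompact case *)

Section power_cdh.
Context (X : set cantor_space).
Local Notation Y := (omega_power X).
Local Notation c := (@omega_code X).

Definition upd (y : Y) N (x : X) : Y := fun i => if i == N then x else y i.

(** A prefix of the code reads finitely many coordinates, so some coordinate stays free. *)
Lemma upd_pre (y : Y) n : exists N, forall x, pre n (c (upd y N x)) = pre n (c y).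
Proof.
have [N NP] := omega_code_pre X n; exists N => x; apply: NP => i lt.
by rewrite /upd ltn_eqF.
Qed.

Lemma Gdelta_range_omega_code : Gdelta X -> Gdelta (range c).
Proof.
move=> [F [Fcl XF]]; exists (fun k z => F (unpair k).2 (slice (unpair k).1 z)); split.
  move=> k z cz; apply: Fcl => m; have [n nP] := slice_pre (unpair k).1 m.
  have [w [Fw we]] := cz n; exists (slice (unpair k).1 w); split=> //.
  exact: nP.
move=> z; split=> [[y _ <-] k|nF].
  by have /XF := omega_code_X y (unpair k).1; apply.
have [|y yz] := @omega_code_surj X z; last by exists y.
by move=> i; apply/XF => k; have := nF (pairn (i, k)); rewrite pairnK.
Qed.

Lemma trivial_cdh : (forall a b : X, a = b) -> countable_dense_homogeneous Y.
Proof.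
move=> X1 A B cA dA cB dB.
have Y1 (x y : Y) : x = y by apply: functional_extensionality_dep => i; exact: X1.
exists id; first by exists id; split=> // x U.
rewrite image_id; apply/seteqP; split=> x _.
  by have [y By _] := dense_nbhs dB (@filterT _ (nbhs x) _); rewrite (Y1 x y).
by have [y Ay _] := dense_nbhs dA (@filterT _ (nbhs x) _); rewrite (Y1 x y).
Qed.

(** Pieces are traces of cylinders, split at the first bit where two codes in the piece differ; it
    exists since a free coordinate can be set to [a] or [b]. Nested pieces have a common point
    because [X] is closed. *)
Lemma compact_cdh (a b : X) : a <> b -> clos X `<=` X -> countable_dense_homogeneous Y.
Proof.
move=> ab clX; have [cinj cnbhs] := @embeds_omega_code X.
have cyl_open u : open [set y | cyl u (c y)].
  rewrite openE => y uy; apply/cnbhs; exists (size u) => y'.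
  by rewrite /cyl /= => ->.
apply: (@scheme_cdh Y bool false
  (fun n P => P !=set0 /\ exists2 u, (n <= size u)%N & P = [set y | cyl u (c y)])).
- split; first by exists (fun=> a).
  by exists [::] => //; apply/seteqP; split.
- move=> n P [Pne [u nu PE]]; move: Pne; rewrite PE => -[y uy].
  have [|m [y1 [y2 [uy1 uy2 ne]]] mmin] := @ex_least (fun m =>
      exists y1 y2, [/\ cyl u (c y1), cyl u (c y2) & c y1 m <> c y2 m]).
    have [N NP] := upd_pre y (size u).
    have ne : c (upd y N a) <> c (upd y N b).
      by move=> /cinj /(congr1 (@^~ N)); rewrite /upd eqxx.
    have [m mP] : exists m, c (upd y N a) m <> c (upd y N b) m.
      by apply: contrapT => /forallNP nm; apply: ne; apply/funext => m; apply: contrapT.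
    exists m, (upd y N a), (upd y N b).
    by split=> //; rewrite /cyl /= NP.
  have mlt y' i : cyl u (c y') -> (i < m)%N -> c y' i = c y i.
    move=> uy' im; apply: contrapT => ne'.
    have : (m <= i)%N by apply: mmin; exists y', y.
    by rewrite leqNgt im.
  have um : (size u <= m)%N.
    rewrite leqNgt; apply/negP => lt; apply: ne.
    by apply: (proj1 (preP (size u) _ _)) lt; rewrite uy1 uy2.
  have cylS d y' : cyl (rcons (pre m (c y)) d) (c y') <-> cyl u (c y') /\ c y' m = d.
    have sz : size (rcons (pre m (c y)) d) = m.+1 by rewrite size_rcons size_pre.
    rewrite /cyl /= sz /pre /mkseq -addn1 iotaD map_cat cats1 add0n; split.
      move=> /rcons_inj[e <-]; split=> //; rewrite -[RHS]uy.
      exact: (@pre_le _ m _ _ um e).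
    move=> [uy' <-]; congr rcons; apply/(preP m) => i im; exact: mlt.
  exists (fun d => [set y' | cyl (rcons (pre m (c y)) d) (c y')]); split.
  + move=> d; split; last first.
      exists (rcons (pre m (c y)) d) => //; rewrite size_rcons size_pre ltnS.
      exact: leq_trans um.
    have [e1|e1] := eqVneq (c y1 m) d; first by exists y1; apply/cylS.
    exists y2; apply/cylS; split=> //.
    by move: ne e1; case: (c y1 m) (c y2 m) d => [] [] [].
  + by move=> d y' /cylS[].
  + by move=> y' uy'; exists (c y' m); apply/cylS.
  + by move=> d d' y' /cylS[_ <-] /cylS[_ <-].
- by move=> n P [Pne [u _ PE]]; split=> //; rewrite PE.
- move=> P PP PS.
  have /choice[u uP] : forall n, exists u, (n <= size u)%N /\ P n = [set y | cyl u (c y)].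
    by move=> n; have [_ [u ? ?]] := PP n; exists u.
  have Pu n y : P n y <-> cyl (u n) (c y) by rewrite (uP n).2.
  have nu n := (uP n).1.
  have P_le n m : (n <= m)%N -> P m `<=` P n.
    move=> /subnK <-; elim: (m - n)%N => [//|k IH] y; rewrite addSn => /PS; exact: IH.
  split.
  + have /choice[y yP] : forall n, exists y, P n y by move=> n; have [] := PP n.
    pose z i := c (y i.+1) i.
    have zu n : cyl (u n) z.
      rewrite /cyl /= -[RHS](_ : pre (size (u n)) (c (y (maxn n (\max_(i < size (u n)) i.+1)))) = u n).
        apply/preP => i lt; set M := maxn _ _.
        have iM : (i.+1 <= M)%N.
          rewrite leq_max; apply/orP; right.
          exact: (@leq_bigmax _ (fun i : 'I_(size (u n)) => i.+1) (Ordinal lt)).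
        have /Pu e1 := P_le _ _ iM _ (yP M); have /Pu e2 := yP i.+1.
        have /preP/(_ i (nu i.+1)) // : pre (size (u i.+1)) (c (y i.+1)) = pre (size (u i.+1)) (c (y M)).
        by rewrite e1 e2.
      by apply/Pu; apply: P_le (yP _); exact: leq_maxl.
    have [|x xz] := @omega_code_surj X z; last by exists x => n; apply/Pu; rewrite xz.
    move=> i; apply: clX => m; have [n nP] := slice_pre i m.
    exists (slice i (c (y n))); split; first exact: omega_code_X.
    apply: nP; apply: pre_le (nu n) _; rewrite zu.
    exact: (proj1 (Pu n _) (yP n)).
  + move=> x y xP yP; apply: cinj; apply: pre_inj => n.
    apply: pre_le (nu n) _.
    by rewrite (proj1 (Pu n _) (xP n)) (proj1 (Pu n _) (yP n)).
  + move=> x U xP /cnbhs[n nU]; exists n => y /Pu uy; apply: nU.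
    by apply: pre_le (nu n) _; rewrite uy (proj1 (Pu n _) (xP n)).
Qed.

(** Pieces are clopen sets on which the first [n] labels, prefixes of length [lev], are constant; by
    [lev_lim], nested pieces shrink to a point of the power. *)
Lemma noncompact_cdh z0 : Gdelta X -> clos X z0 -> ~ X z0 ->
  countable_dense_homogeneous Y.
Proof.
move=> GX cz0 nz0; have [cinj cnbhs] := @embeds_omega_code X.
have [lev [lev_ge levS lev_eq lev_lim]] := Gdelta_level (Gdelta_range_omega_code GX).
have rc (y : Y) : range c (c y) by exists y.
pose lab n (y : Y) := pre (lev n (c y)) (c y).
have labP n (x y : Y) : lab n y = lab n x <-> pre (lev n (c x)) (c y) = pre (lev n (c x)) (c x).
  split=> [e|e].
    have: lev n (c y) = lev n (c x) by move: e => /(congr1 size); rewrite !size_pre.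
    by move=> {1}<-.
  by rewrite /lab (lev_eq _ _ _ (rc x) e).
have lev_lab n (x y : Y) : lab n x = lab n y -> lev n (c x) = lev n (c y).
  by move=> /(congr1 size); rewrite !size_pre.
have [x0 Xx0] : exists x0, X x0 by have [x0 []] := cz0 0%N; exists x0.
apply: (@scheme_cdh Y nat 0%N (fun n P => [/\ P !=set0, open P, closed P &
  forall k x y, (k < n)%N -> P x -> P y -> lab k x = lab k y])).
- split; [|exact: openT|exact: closedT|by []].
  by exists (fun=> exist _ x0 (mem_set Xx0)).
- move=> n P [[y Py] oP cP PL].
  have /cnbhs[m mP] : nbhs y P by exact: open_nbhs_nbhs.
  have [N NP] := upd_pre y m.
  (* Coordinate [N] is free inside [P], and its level of agreement with [z0] is
     unbounded: this provides infinitely many clopen pieces. *)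
  have /choice[lv lvP] : forall x : Y, exists l, pre l (\val (x N)) <> pre l z0 /\
      forall i, (i < l)%N -> pre i (\val (x N)) = pre i z0.
    move=> x; have [|l ne lmin] := @ex_least (fun l => pre l (\val (x N)) <> pre l z0).
      by apply: pre_neq => xz; apply: nz0; rewrite -xz; exact: set_valP.
    exists l; split=> // i il; apply: contrapT => /lmin.
    by rewrite leqNgt il.
  have lv_eq (x x' : Y) : pre (lv x) (\val (x' N)) = pre (lv x) (\val (x N)) -> lv x' = lv x.
    move=> e; have [ne lx] := lvP x; have [ne' lx'] := lvP x'.
    have [lt|lt|//] := ltngtP (lv x') (lv x); exfalso.
      by apply: ne'; rewrite -(lx _ lt); exact: pre_le (ltnW lt) e.
    by apply: ne; rewrite -(lx' _ lt).
  (* The label gives the constancy required at the next stage, [lv] gives infinitely many values;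
     both are locally constant, so the fibres of [phi] in [P] are clopen. *)
  pose phi x := (lab n x, lv x).
  have phi_loc x : nbhs x [set x' | phi x' = phi x].
    have [k kP] := slice_pre N (lv x).
    apply/cnbhs; exists (maxn k (lev n (c x))) => x' e; rewrite /phi; congr pair.
      by apply/labP; exact: pre_le (leq_maxr _ _) e.
    by apply: lv_eq; rewrite -!slice_omega_code; apply: kP; exact: pre_le (leq_maxl _ _) e.
  have infP : infinite_set (phi @` P).
    move=> /finite_seqP[s sP].
    (* A point agreeing with [z0] beyond every listed level, put in coordinate [N], yields a value
       outside the list. *)
    have [x [Xx xz]] := cz0 (\max_(v <- s) v.2).+1.
    pose x' := upd y N (exist _ x (mem_set Xx)).
    have : phi x' \in s.
      have : (phi @` P) (phi x') by exists x' => //; apply: mP; exact: NP.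
      by rewrite sP.
    move=> /(@leq_bigmax_seq _ s xpredT snd) /(_ isT) /= le.
    have [ne _] := lvP x'; apply: ne.
    by apply: pre_le (leqW le) _; rewrite /x' /upd eqxx.
  have /card_set_bijP[f [_ finj fsurj]] := eq_card_nat (countableP _) infP.
  exists (fun j => [set x | P x /\ f (phi x) = j]); split.
  + move=> j; split.
    * have [v [x Px <-] fj] := fsurj j I; by exists x.
    * rewrite openE => x [Px fx].
      apply: (@filterS2 _ (nbhs x) _ P [set x' | phi x' = phi x]) => //.
        by move=> x' Px' /= e; split=> //; rewrite e.
      exact: open_nbhs_nbhs.
    * move=> x clx; split.
        apply: cP => U xU; have [x' [[Px' _] Ux']] := clx U xU.
        by exists x'.
      by have [x' [[_ <-] /= ->]] := clx _ (phi_loc x).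
    * move=> k x x' kn [Px fx] [Px' fx'].
      move: kn; rewrite ltnS leq_eqVlt => /orP[/eqP ->|kn]; last exact: PL.
      have : phi x = phi x' by apply: finj; rewrite ?inE; [exists x|exists x'|rewrite fx].
      by case.
  + by move=> j x [].
  + by move=> x Px; exists (f (phi x)).
  + by move=> j j' x [_ <-] [_ <-].
- by move=> n P [].
- move=> P PP PS.
  have PL n x y : P n.+1 x -> P n.+1 y -> lab n x = lab n y.
    by have [_ _ _] := PP n.+1; apply.
  have P_le n m : (n <= m)%N -> P m `<=` P n.
    move=> /subnK <-; elim: (m - n)%N => [//|k IH] y; rewrite addSn => /PS; exact: IH.
  split.
  + have /choice[y yP] : forall n, exists y, P n y by move=> n; have [] := PP n.
    have [|n|n|z zP] := @pre_lim (fun n => lev n (c (y n.+1))) (fun n => c (y n.+1)).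
    * by move=> n; exact: lev_ge.
    * rewrite (lev_lab _ _ _ (PL n (y n.+1) (y n.+2) (yP _) (PS _ _ (yP _)))).
      exact: levS.
    * by apply/labP; apply: PL => //; exact: PS.
    have [x _ xz] : range c z by apply: lev_lim => n; exists (c (y n.+1)).
    exists x => n; have [_ _ cPn _] := PP n; apply: cPn => U /cnbhs[m mU].
    exists (y (maxn n m).+1); split.
      by apply: P_le (yP _); apply: leqW; exact: leq_maxl.
    apply: mU; apply/esym; rewrite xz.
    apply: pre_le (zP (maxn n m)); apply: leq_trans (lev_ge _ _ (rc _)).
    exact: leq_maxr.
  + move=> x y xP yP; apply: cinj; apply: pre_inj => n.
    apply: pre_le (lev_ge n _ (rc y)) _.
    by apply/labP; exact: PL.
  + move=> x U xP /cnbhs[n nU]; exists n.+1 => y yP; apply: nU.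
    apply: pre_le (lev_ge n _ (rc x)) _.
    by apply/labP; exact: PL.
Qed.

End power_cdh.

(** * Failure of homogeneity *)

Lemma embeds_continuous (S T : topologicalType) (c : S -> nat -> bool)
    (d : T -> nat -> bool) (h : S -> T) : embeds c -> embeds d -> continuous h ->
  forall x n, exists m, forall y, pre m (c y) = pre m (c x) -> pre n (d (h y)) = pre n (d (h x)).
Proof.
move=> [_ cn] [_ dn] hc x n.
have nh : nbhs (h x) [set y | pre n (d y) = pre n (d (h x))] by apply/dn; exists n.
by have /cn[m mP] := hc x _ nh; exists m.
Qed.

Lemma countable_union (T : Type) (A B : set T) :
  countable A -> countable B -> countable (A `|` B).
Proof.
move=> cA cB; rewrite -bigcup2E; apply: bigcup_countable => // -[|[|i]] _ //=.
Qed.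

Section not_cdh.
Context (X : set cantor_space).
Local Notation Y := (omega_power X).
Local Notation c := (@omega_code X).
Let cE := @embeds_omega_code X.

Lemma clos_slice H i : clos [set z | clos H (slice i z)] `<=` [set z | clos H (slice i z)].
Proof.
move=> z cz; apply: clos_clos => m; have [n nP] := slice_pre i m.
by have [w [Hw we]] := cz n; exists (slice i w); split=> //; exact: nP.
Qed.

(** Homogeneity would carry [Q'], a copy of [Q] closed in the power, to a closed subset whose points
    have all coordinates outside the closures of the [H k]. Its limits outside the power have a
    slice in some [H k], so a countable crowded set would be a G_delta. *)
Lemma not_cdh_dense_polish (Q : set (nat -> bool)) :
  meager_in X (~` X) -> countable Q -> Q !=set0 -> Q `<=` X -> X `&` clos Q `<=` Q ->
  (forall q n, Q q -> exists q', [/\ Q q', q' <> q & pre n q' = pre n q]) ->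
  ~ countable_dense_homogeneous Y.
Proof.
move=> [H [ndH HX]] cQ [q0 Qq0] QX Qcl Qcr cdh.
pose y0 : Y := fun=> exist _ q0 (mem_set (QX _ Qq0)).
have [|e de eP] := @embeds_dense Y c y0
    (fun _ y => forall i n, ~ clos (H n) (\val (y i))) cE.
  move=> n _ y; have [N NP] := omega_code_pre X n.
  have /choice[x xP] : forall i, exists x : X, pre N (\val x) = pre N (\val (y i)) /\
      forall k, ~ clos (H k) (\val x).
    move=> i; have [x [Xx /cyl_pre ux xH]] := avoid_meager ndH HX (meets_cyl_pre N (set_valP (y i))).
    by exists (exist _ x (mem_set Xx)).
  exists x; split; first by apply: NP => i _; have [] := xP i.
  by move=> i k; have [_] := xP i; exact.
pose Q' := [set upd y0 0%N x | x in [set x : X | Q (\val x)]].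
have Q'P y : Q' y <-> Q (\val (y 0%N)) /\ forall i, i != 0%N -> y i = y0 i.
  split=> [[x Qx <-]|[Qy yi]].
    by rewrite /upd eqxx; split=> // i /negbTE ->.
  exists (y 0%N) => //; apply: functional_extensionality_dep => i; rewrite /upd.
  by have [->//|/yi] := eqVneq i 0%N.
have cQ' : countable Q'.
  apply: card_le_trans (card_image_le _ _) _.
  move: cQ => /pcard_leTP/unsquash g; apply/pcard_injP; exists (fun x => g (\val x)).
  move=> x x'; rewrite !inE /= => Qx Qx' gx; apply: val_inj.
  by apply: (@inj _ _ _ g); rewrite ?inE.
have [h [g [hg gh hc gc]] hA] : exists2 h : Y -> Y, homeomorphism h & h @` range e = range e `|` Q'.
  apply: cdh => //; first exact: countable_range.
    by apply: countable_union => //; exact: countable_range.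
  move=> O O0 oO; have [y [Oy ey]] := de O O0 oO.
  by exists y; split=> //; left.
have gQ' y : Q' y -> exists u, g y = e u.
  move=> Qy; have : (range e `|` Q') y by right.
  by rewrite -hA => -[_ [u _ <-] <-]; exists u; rewrite hg.
have cinj := cE.1.
apply: (@crowded_countable_not_Gdelta (c @` (g @` Q'))
  (fun k => [set z | clos (H (unpair k).2) (slice (unpair k).1 z)])).
- by do 2 apply: card_le_trans (card_image_le _ _) _.
- exists (c (g y0)), (g y0) => //; exists y0 => //.
  by apply/Q'P.
- move=> _ n [_ [y Qy <-] <-]; have [m mP] := embeds_continuous cE cE gc y n.
  have [N NP] := omega_code_pre X m; have [Qy0 yi] := proj1 (Q'P y) Qy.
  have [q' [Qq' q'y e']] := Qcr _ N Qy0.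
  pose y' := upd y0 0%N (exist _ q' (mem_set (QX _ Qq'))).
  have Qy' : Q' y' by exists (exist _ q' (mem_set (QX _ Qq'))).
  exists (c (g y')); split.
  + by exists (g y') => //; exists y'.
  + move=> /cinj /(can_inj gh) /(congr1 (fun y : Y => \val (y 0%N))).
    by rewrite /y' /upd eqxx.
  + apply: mP; apply: NP => i _; rewrite /y' /upd.
    by have [->|i0] := eqVneq i 0%N; [exact: e'|rewrite yi].
- move=> k _ [_ [y Qy <-] <-] /clos_slice /=; rewrite slice_omega_code.
  by have [u ->] := gQ' y Qy; exact: eP.
- move=> z cz; have [[k Fk]|nF] := pselect (exists k, clos (H (unpair k).2) (slice (unpair k).1 z)).
    by right; exists k.
  left; have [|y yz] := @omega_code_surj X z.
    move=> i; apply: contrapT => /HX[n _ Hn]; apply: nF; exists (pairn (i, n)).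
    by rewrite pairnK; exact: clos_sub.
  exists y => //; exists (h y) => //; apply/Q'P.
  have hy i m : exists2 y', Q' y' & pre m (\val (y' i)) = pre m (\val (h y i)).
    have [n nP] := slice_pre i m.
    have [k kP] := embeds_continuous cE cE hc y n.
    have [_ [[_ [y' Qy' <-] <-] we]] := cz k; exists y' => //.
    rewrite -!slice_omega_code; apply: nP; rewrite -[y'](gh y'); apply: kP.
    by rewrite we yz.
  split=> [|i i0].
    apply: Qcl; split=> [|m]; first exact: set_valP.
    have [y' /Q'P[Qy' _] e'] := hy 0%N m; by exists (\val (y' 0%N)).
  apply: val_inj; apply: pre_inj => m.
  by have [y' /Q'P[_ yi] <-] := hy i m; rewrite yi.
Qed.

(** Choosing [e v] outside [F (pickle v)] makes the dense set [range e] a G_delta of the power. A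
    homeomorphism onto its union with [range e2] would make the trace of that union on the compact
    set [C] a countable crowded G_delta. *)
Lemma not_cdh_meager u (a b : X) : a <> b -> meets_cyl X u -> meager_in X (X `&` cyl u) ->
  ~ countable_dense_homogeneous Y.
Proof.
move=> ab [xu Xxu uxu] [H [ndH HX]] cdh.
(* Increasing closed sets with empty interior that cover the power. *)
pose F n : set (nat -> bool) := [set z |
  (exists2 j, (j <= n)%N & clos (H (unpair j).2) (slice (unpair j).1 z)) \/
  forall i, ~ cyl u (slice i z)].
have F_le n m : (n <= m)%N -> F n `<=` F m.
  by move=> nm z [[j jn Hj]|Hz]; [left; exists j => //; exact: leq_trans nm|right].
have F_clos n : clos (F n) `<=` F n.
  move=> z cz; apply: contrapT => /not_orP[nj /existsNP[i /contrapT ui]].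
  have /choice[l lP] : forall j, exists l, (j <= n)%N -> forall w, pre l w = pre l z ->
      ~ clos (H (unpair j).2) (slice (unpair j).1 w).
    move=> j; have [jn|jn] := leqP j n; last by exists 0%N.
    have [l lP] : exists l, forall w, pre l w = pre l z -> ~ clos (H (unpair j).2) (slice (unpair j).1 w).
      apply: (@not_clos [set w | clos (H (unpair j).2) (slice (unpair j).1 w)]).
      by move=> /clos_slice Hj; apply: nj; exists j.
    by exists l.
  have [k kP] := slice_pre i (size u).
  have [w [Fw we]] := cz (maxn k (\max_(j < n.+1) l j)).
  case: Fw => [[j jn]|/(_ i)]; last first.
    by apply; rewrite /cyl /= (kP w z) //; apply: pre_le we; exact: leq_maxl.
  apply: lP => //; apply: pre_le we; rewrite leq_max; apply/orP; right.
  exact: (@leq_bigmax _ (fun j : 'I_n.+1 => l j) (Ordinal (jn : (j < n.+1)%N))).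
have [|e de eP] := @embeds_dense Y c (fun=> a) (fun k y => ~ F k (c y)) cE.
  move=> n k y; have [N NP] := omega_code_pre X n.
  pose K := (\max_(j < k.+1) (unpair j).2).+1.
  have avoid v : meets_cyl X v -> exists x : X, cyl v (\val x) /\
      forall i, (i < K)%N -> ~ clos (H i) (\val x).
    move=> /(avoid_finite K ndH)[v' [vv' [x Xx v'x] Hv']].
    exists (exist _ x (mem_set Xx)); split; first exact: (prefix_cyl vv').
    move=> i iK /(_ (size v'))[w [Hw we]]; apply: (Hv' i w iK _ Hw).
    by rewrite /cyl /= we.
  (* Coordinate [N], which the prefix of length [n] does not read, enters [cyl u] and defeats the
     second clause of [F]; avoiding [H i] for [i < K] defeats the first. *)
  have /choice[x xP] : forall i, exists x : X,
      cyl (if i == N then u else pre N (\val (y i))) (\val x) /\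
      forall i, (i < K)%N -> ~ clos (H i) (\val x).
    move=> i; apply: avoid; case: eqP => _; first by exists xu.
    exact: meets_cyl_pre (set_valP (y i)).
  exists x; split.
    by apply: NP => i iN; have [+ _] := xP i; rewrite ltn_eqF // => /cyl_pre.
  move=> [[j jk]|/(_ N)]; rewrite slice_omega_code.
    have [_ +] := xP (unpair j).1; apply; rewrite ltnS.
    exact: (@leq_bigmax _ (fun j : 'I_k.+1 => (unpair j).2) (Ordinal (jk : (j < k.+1)%N))).
  by apply; have [+ _] := xP N; rewrite eqxx.
have [cinj cn] := cE.
(* [F n] contains only finitely many [e v]; small neighbourhoods of these are
   removed, so that the complement of [range e] is the union of the [G k]. *)
pose G k : set Y := [set y | F (unpair k).1 (c y) /\
  forall v, (pickle v <= (unpair k).1)%N -> pre (unpair k).2 (c y) <> pre (unpair k).2 (c (e v))].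
have G_cover y : range e y \/ exists k, G k y.
  have [?|ney] := pselect (range e y); [by left|right].
  have [n Fn] : exists n, F n (c y).
    have [[i ui]|nu] := pselect (exists i, cyl u (\val (y i))); last first.
      by exists 0%N; right=> i; rewrite slice_omega_code => ui; apply: nu; exists i.
    have [k _ Hk] := HX _ (conj (set_valP (y i)) ui).
    exists (pairn (i, k)); left; exists (pairn (i, k)) => //.
    by rewrite pairnK slice_omega_code; exact: clos_sub.
  have /choice[l lP] : forall v, exists l, pre l (c y) <> pre l (c (e v)).
    by move=> v; apply: pre_neq => /cinj ye; apply: ney; exists v.
  pose L j := if unpickle j is Some v then l v else 0%N.
  have LE v : L (pickle v) = l v by rewrite /L pickleK.
  exists (pairn (n, \max_(j < n.+1) L j)); rewrite /G pairnK; split=> // v vn e_yv.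
  apply: (lP v); apply: pre_le e_yv; rewrite -LE.
  exact: (@leq_bigmax _ (fun j : 'I_n.+1 => L j) (Ordinal (vn : (pickle v < n.+1)%N))).
have G_away v k : exists n, forall y, pre n (c y) = pre n (c (e v)) -> ~ G k y.
  have [vk|vk] := leqP (pickle v) (unpair k).1.
    by exists (unpair k).2 => y ye [_ /(_ v vk)].
  have [n nP] : exists n, forall w, pre n w = pre n (c (e v)) -> ~ F (unpair k).1 w.
    by apply: not_clos => /F_clos /(F_le _ _ (ltnW vk)); exact: eP.
  by exists n => y /nP nF [].
pose C : set Y := [set y | forall i, y i = a \/ y i = b].
(* The default [false] makes these the sequences in [C] that are eventually [a]. *)
pose e2 (s : seq bool) : Y := fun i => if nth false s i then b else a.
have e2C s : C (e2 s) by move=> i; rewrite /e2; case: nth; [right|left].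
have [h [g [hg gh hc gc]] hA] : exists2 h : Y -> Y, homeomorphism h & h @` range e = range e `|` range e2.
  apply: cdh => //; first exact: countable_range.
    by apply: countable_union => //; exact: countable_range.
  move=> O O0 oO; have [y [Oy ey]] := de O O0 oO.
  by exists y; split=> //; left.
apply: (@crowded_countable_not_Gdelta (c @` ((range e `|` range e2) `&` C))
  (fun k => c @` (h @` G k))).
- apply: card_le_trans (card_image_le _ _) _.
  apply: (@sub_countable _ _ _ (range e `|` range e2)); first by apply: subset_card_le => y [].
  by apply: countable_union => //; exact: countable_range.
- by exists (c (e2 [::])), (e2 [::]) => //; split=> //; right; exists [::].
- move=> _ n [y [_ Cy] <-]; have [N NP] := omega_code_pre X n.
  (* [e2 s] equals [y] on the first [N] coordinates and takes the other value at coordinate [N]. *)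
  pose s := mkseq (fun i => if (i < N)%N then y i == b else y i != b) N.+1.
  have e2s i : (i <= N)%N -> e2 s i = if (i < N)%N then y i else if y i == b then a else b.
    move=> iN; rewrite /e2 nth_mkseq //; case: (i < N)%N; last by case: eqP.
    by case: eqP => [-> //|yb]; case: (Cy i) => [->|/yb].
  exists (c (e2 s)); split.
  + by exists (e2 s) => //; split=> //; right; exists s.
  + move=> /cinj /(congr1 (@^~ N)); rewrite e2s // ltnn.
    by case: eqP => [-> //|yb eb]; apply: yb.
  + by apply: NP => i iN; rewrite e2s ?iN // ltnW.
- move=> k _ [y [By Cy] <-] cF.
  have [v gy] : exists v, g y = e v.
    by move: By; rewrite -hA => -[_ [v _ <-] <-]; exists v; rewrite hg.
  have [n nP] := G_away v k; have [m mP] := embeds_continuous cE cE gc y n.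
  have [_ [[_ [y' Gy' <-] <-] we]] := cF m.
  by apply: (nP y') => //; rewrite -gy -(mP _ we) hg.
- move=> z cz; have zab i : slice i z = \val a \/ slice i z = \val b.
    apply: contrapT => /not_orP[/pre_neq[m1 n1] /pre_neq[m2 n2]].
    have [n nP] := slice_pre i (maxn m1 m2).
    have [_ [[y [_ Cy] <-] /nP]] := cz n; rewrite slice_omega_code.
    case: (Cy i) => -> e1; [apply: n1|apply: n2]; apply/esym; apply: pre_le e1.
      exact: leq_maxl.
    exact: leq_maxr.
  have [|y yz] := @omega_code_surj X z.
    by move=> i; case: (zab i) => ->; exact: set_valP.
  have Cy : C y.
    move=> i; case: (zab i) => zi; [left|right]; apply: val_inj;
      by rewrite /= -slice_omega_code yz.
  have [gy|[k Gk]] := G_cover (g y); last first.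
    by right; exists k => //; exists y => //; exists (g y).
  left; exists y => //; split=> //.
  by rewrite -hA; exists (g y).
Qed.

End not_cdh.

Theorem theorem4p5 (R : realType) (X : set cantor_space) (hX : coanalytic R X) :
  polish R X <-> countable_dense_homogeneous (omega_power X).
Proof.
split=> [/polish_Gdelta GX|cdh].
  have [X1|/existsNP[a /existsNP[b ab]]] := pselect (forall a b : X, a = b).
    exact: trivial_cdh.
  have [clX|/existsNP[z /not_implyP[cz nz]]] := pselect (clos X `<=` X).
    exact: compact_cdh ab clX.
  exact: noncompact_cdh GX cz nz.
apply: Gdelta_polish; apply: contrapT => nG.
have [S [S0 SS S_pre S_lim]] := analytic_scheme hX.
have [Q [cQ Q0 QX Qcl Qcr]] := hurewicz S0 SS S_pre S_lim nG.
have [[u Tu mu]|mX] := baire_dichotomy S0 SS S_lim.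
  (* Being crowded, [Q] has two distinct points, which serve as [a] and [b]. *)
  have [q Qq] := Q0; have [q' [Qq' q'q _]] := Qcr q 0%N Qq.
  pose a : X := exist _ q (mem_set (QX _ Qq)).
  pose b : X := exist _ q' (mem_set (QX _ Qq')).
  by apply: (@not_cdh_meager X u b a) Tu mu cdh => /(congr1 val).
exact: not_cdh_dense_polish mX cQ Q0 QX Qcl Qcr cdh.
Qed.
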